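(* Let $m\ge1$ and $k$ be integers with $0\le k\le m$. Let $A=\mathbf{A}_{\mathrm{Bin}}(S_m,\mathcal{F},k)$ be the $m!\times m!$ matrix with rows and columns indexed by $S_m$ and $(\sigma,\tau)$-entry $\binom{\mathcal{F}(\tau\sigma^{-1})}{k}$, where $\mathcal{F}(\pi)$ is the number of fixed points of $\pi\in S_m$. For a partition $\mu\vdash m$ with associated irreducible character $\chi^\mu$ of $S_m$, set $$\lambda_\mu=\frac{\binom{m}{k}\,(m-k)!\,\mathrm{Crop}(\mu,k)}{\chi^\mu(\mathrm{id})}=\frac{\mathrm{Crop}(\mu,k)/k!}{\mathrm{Crop}(\mu,m)/m!}.$$ Then: (1) each $\lambda_\mu$ is an eigenvalue of $A$; (2) the eigenvalues of $A$, counted with multiplicity, are exactly the values $\lambda_\mu$, $\mu\vdash m$, where $\lambda_\mu$ is counted $\chi^\mu(\mathrm{id})^2$ times (so the multiplicity of a real number $\lambda$ is $\sum_{\mu:\lambda_\mu=\lambda}\chi^\mu(\mathrm{id})^2$); (3) each $\lambda_\mu$ is an integer; (4) $0\le\lambda_\mu\le\binom{m}{k}(m-k)!$.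
   Context: For a partition $\mu=(\mu_1,\dots,\mu_\ell)$ of $m$, its Young diagram is $\{(i,j)\in\mathbb{Z}^2:1\le i\le\ell,\ 1\le j\le\mu_i\}$. A rim hook of length $1$ is a single square whose removal leaves a (possibly empty) Young diagram. For $0\le k\le m$, $\mathrm{Crop}(\mu,k)$ is the number of ways to reduce the Young diagram of $\mu$ to the single-row Young diagram of length $m-k$ by successively removing $k$ rim hooks of length $1$. Irreducible characters of $S_m$ are indexed by partitions of $m$ in the standard way. *)

(* Defs.v *)
From mathcomp Require Import all_boot all_order all_fingroup all_algebra.
From mathcomp Require Import all_field all_character.

Set Implicit Arguments.
Unset Strict Implicit.
Unset Printing Implicit Defensive.

Import Order.TTheory GRing.Theory Num.Theory.

Local Open Scope ring_scope.

(* Partitions of m: weakly decreasing sequences of positive integers with sum m.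
   The bounds on the length and on the parts hold for every partition of m; they
   only serve to make the type finite. *)
Definition is_intpart (m : nat) (s : seq nat) : bool :=
  [&& sorted geq s, all (leq 1) s & sumn s == m].

Definition intpart (m : nat) : predArgType :=
  {s : {bseq m of 'I_m.+1} | is_intpart m (map val s)}.

Definition parts (m : nat) (mu : intpart m) : seq nat := map val (val mu).

(* Cells are 0-indexed pairs (row, column). The ambient N x N square contains the
   whole diagram as soon as n <= N. *)
Definition diagram (N n : nat) (mu : intpart n) : {set 'I_N * 'I_N} :=
  [set c : 'I_N * 'I_N | (c.2 < nth 0 (parts mu) c.1)%N].

Definition is_diagram (N : nat) (D : {set 'I_N * 'I_N}) : bool :=
  [exists n : 'I_N.+1, [exists mu : intpart n, D == diagram N mu]].

Definition row_diagram (N r : nat) : {set 'I_N * 'I_N} :=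
  [set c : 'I_N * 'I_N | ((c.1 == 0 :> nat) && (c.2 < r))%N].

(* Removing the cells of s from D one after the other is a succession of removals
   of rim hooks of length 1 which ends with the diagram E. *)
Fixpoint crops (N : nat) (E D : {set 'I_N * 'I_N}) (s : seq ('I_N * 'I_N)) : bool :=
  if s is c :: s' then [&& c \in D, is_diagram (D :\ c) & crops E (D :\ c) s']
  else D == E.

Definition Crop (m : nat) (mu : intpart m) (k : nat) : nat :=
  #|[set s : k.-tuple ('I_m * 'I_m) | crops (row_diagram m (m - k)) (diagram m mu) s]|.

(* The irreducible character chi^mu of S_m is the character of the Specht module
   C[S_m] c_mu, where c_mu = (\sum_p p) (\sum_q sgn(q) q) is the Young symmetrizer,
   p and q ranging over the permutations preserving the rows and the columns of
   the tableau of shape mu filled with 0, ..., m - 1 row by row: the entry x is in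
   row reshape_index (parts mu) x and in column reshape_offset (parts mu) x. *)
Definition row_group (m : nat) (mu : intpart m) : {set 'S_m} :=
  [set p : 'S_m | [forall x : 'I_m,
     reshape_index (parts mu) (p x) == reshape_index (parts mu) x]].

Definition col_group (m : nat) (mu : intpart m) : {set 'S_m} :=
  [set q : 'S_m | [forall x : 'I_m,
     reshape_offset (parts mu) (q x) == reshape_offset (parts mu) x]].

(* In mathcomp s * t is "s, then t", so that the composite of functions p \o q is
   (q * p)%g, and multiplying c_mu on the left by g for composition is the action
   of g in the regular representation of mathcomp, which is on row vectors. *)
Definition young_symmetrizer (m : nat) (mu : intpart m) :
    'rV[algC]_(gcard [set: 'S_m]) :=
  \sum_(p in row_group mu) \sum_(q in col_group mu)
     (-1) ^+ q *: delta_mx 0 (gring_index [set: 'S_m] (q * p)%g).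

Definition specht_char (m : nat) (mu : intpart m) : 'CF([set: 'S_m]) :=
  cfRepr (submod_repr (cyclic_mx_module (regular_repr algC [set: 'S_m]%G)
                                        (young_symmetrizer mu))).

Definition nfix (m : nat) (s : 'S_m) : nat := #|[set x : 'I_m | s x == x]|.

(* The composite tau \o sigma^-1 is (sigma^-1 * tau)%g. *)
Definition ABin (m k : nat) : 'M[algC]_#|{: 'S_m}| :=
  \matrix_(i, j) 'C(nfix ((enum_val i)^-1 * enum_val j)%g, k)%:R.

Definition lambda (m k : nat) (mu : intpart m) : algC :=
  ('C(m, k) * (m - k)`! * Crop mu k)%:R / specht_char mu 1%g.

(* Main.v *)
Require Import Defs.
From mathcomp Require Import all_boot all_order all_fingroup all_algebra.
From mathcomp Require Import all_field all_character.
From mathcomp Require Import ring zify.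

(* The matrix is the action of the class function f(s) = C(fix s, k) on the regular
   representation, so each irreducible character chi contributes the eigenvalue
   (sum_s f(s) chi(s)) / chi(1) with multiplicity chi(1)^2.  Writing f(s) as the
   number of k-subsets fixed pointwise by s turns the numerator into
   C(m,k) (m-k)! times the multiplicity of the trivial character in the
   restriction of chi to S_(m-k).

   It remains to see that the Specht characters are all the irreducible characters
   and that this multiplicity is n_mu = Crop(mu, k) for chi^mu.  Young symmetrizers
   give irreducible and pairwise distinct characters.  Applying the symmetrizer to
   the standard tableaux with 0, ..., m-k-1 in the first row, which encode the
   croppings, gives independent invariants, whence n_mu >= Crop(mu, k) and, for
   k = m, chi^mu(1) >= Crop(mu, m).  Conversely
   sum_mu n_mu chi^mu(1) <= sum_chi <chi, 1>_(S_(m-k)) chi(1) = m! / (m-k)!, which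
   equals sum_mu Crop(mu, k) Crop(mu, m): this is a formal consequence of the fact
   that a Young diagram has one more addable than removable corner.  So all these
   inequalities are equalities. *)

Set Implicit Arguments.
Unset Strict Implicit.
Unset Printing Implicit Defensive.

Import Order.TTheory GRing.Theory Num.Theory.

(** * Tableaux and croppings *)

Section Tableau.

Variables (m : nat) (mu : intpart m).

Definition width i := nth 0 (parts mu) i.
Definition trow (x : 'I_m) := reshape_index (parts mu) x.
Definition tcol (x : 'I_m) := reshape_offset (parts mu) x.

Lemma intpartP : [/\ sorted geq (parts mu), all (leq 1) (parts mu)
                   & sumn (parts mu) = m].
Proof. by have /and3P[? ? /eqP] := valP mu. Qed.

Lemma sumn_parts : sumn (parts mu) = m.
Proof. by case: intpartP. Qed.

Lemma width_leq i j : (i <= j)%N -> (width j <= width i)%N.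
Proof.
move=> le_ij; have [sorted_mu _ _] := intpartP.
case: (ltnP j (size (parts mu))) => [lt_j|ge_j]; last first.
  by rewrite /width nth_default.
have geq_tr : transitive geq by move=> a b c ba ac; apply: leq_trans ac ba.
apply: (sorted_leq_nth geq_tr leqnn 0 sorted_mu i j _ _ le_ij) => //.
by rewrite inE (leq_ltn_trans le_ij).
Qed.

Lemma width_gt0 i : (0 < width i)%N = (i < size (parts mu))%N.
Proof.
have [_ /allP pos _] := intpartP; rewrite /width.
case: (ltnP i) => [lt_i|ge_i]; last by rewrite nth_default.
by rewrite pos ?mem_nth.
Qed.

Lemma tcol_lt x : (tcol x < width (trow x))%N.
Proof. by rewrite reshape_offsetP ?sumn_parts. Qed.

Lemma tcell_inj x y : trow x = trow y -> tcol x = tcol y -> x = y.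
Proof.
move=> rxy cxy; apply: val_inj => /=.
by rewrite -(reshape_indexK (parts mu) x) -/(trow x) -/(tcol x) rxy cxy reshape_indexK.
Qed.

Lemma tcell_ex i j : (j < width i)%N -> exists2 x, trow x = i & tcol x = j.
Proof.
move=> lt_j; have lt_m := flatten_indexP lt_j; rewrite sumn_parts in lt_m.
exists (Ordinal lt_m); first exact: flatten_indexKl.
exact: flatten_indexKr.
Qed.

Lemma card_trow i : #|[set x | trow x == i]| = width i.
Proof.
have ex (j : 'I_(width i)) : {x | (trow x == i) && (tcol x == j :> nat)}.
  by apply: sigW; have [x rx cx] := tcell_ex (ltn_ord j); exists x; rewrite rx cx !eqxx.
have exP j : trow (sval (ex j)) = i /\ tcol (sval (ex j)) = j.
  by case: (ex j) => x /= /andP[/eqP-> /eqP->].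
rewrite -[RHS]card_ord -cardsT -(@card_imset _ _ (fun j => sval (ex j))) => [|j j' e].
  apply: eq_card => x; rewrite inE; apply/eqP/imsetP=> [rx|[j _ ->]].
    have lt_x : tcol x < width i by rewrite -rx tcol_lt.
    exists (Ordinal lt_x) => //; apply: tcell_inj.
      by rewrite rx (exP _).1.
    by rewrite (exP _).2.
  exact: (exP j).1.
by apply: val_inj; rewrite /= -(exP j).2 -(exP j').2 e.
Qed.

(** Column heights, that is, the parts of the conjugate partition: row lengths decrease, so the
    index of the first row of length at most [j] counts the longer rows. *)
Definition theight j := find (fun n => n <= j)%N (parts mu).

Lemma theightP i j : (j < width i)%N = (i < theight j)%N.
Proof.
apply/idP/idP=> [|lt_i]; last first.
  by rewrite ltnNge /width; have := before_find 0 lt_i => ->.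
rewrite !ltnNge; apply: contra => /width_leq le_w; apply: leq_trans le_w _.
rewrite /width; case: (boolP (has (fun n => n <= j)%N (parts mu))).
  exact: nth_find.
by rewrite /theight => /hasNfind ->; rewrite nth_default.
Qed.

End Tableau.

Lemma intpart_eq m (la mu : intpart m) : width la =1 width mu -> la = mu.
Proof.
move=> eq_w; apply: val_inj; apply: val_inj => /=.
apply: (inj_map val_inj); apply: (@eq_from_nth _ 0); last by move=> i _; apply: eq_w.
rewrite -[size (map _ (val la))]/(size (parts la)) -[size (map _ (val mu))]/(size (parts mu)).
apply/eqP; rewrite eqn_leq.
rewrite leqNgt -width_gt0 eq_w width_gt0 ltnn /=.
by rewrite leqNgt -width_gt0 -eq_w width_gt0 ltnn.
Qed.

(** The statistic n(mu). It makes any two partitions comparable and takes the place of the dominance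
    order in what follows. *)
Definition nstat m (mu : intpart m) := \sum_x trow mu x.

(* The map u |-> (trow la (g u), tcol mu u) is injective, and its image has the column
   sizes of mu.  Pushing the cells of the image up in their columns gives the diagram
   of mu and decreases the sum of the row indices, unless nothing moves. *)
Lemma tableau_match m (la mu : intpart m) (g : 'S_m) :
    (nstat la <= nstat mu)%N ->
    (forall u v, tcol mu u = tcol mu v -> trow la (g u) = trow la (g v) -> u = v) ->
  la = mu /\ exists q : 'S_m, forall u, tcol mu (q u) = tcol mu u
                                   /\ trow mu (q u) = trow mu (g u).
Proof.
move=> le_n inj.
pose h u := theight mu (tcol mu u).
(* [F y] counts the cells from [y] down to the bottom of its column, [y] included, so it is
   positive. *)
pose F y := h y - trow mu y.
pose B := [set u | trow la (g u) < h u].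
(* For [u] in [B], the column of [u] in [mu] reaches row [trow la (g u)], and [phi u] is the cell
   there. Outside [B] the value is irrelevant. *)
have phi_ex u : {y | (u \in B) ==> (trow mu y == trow la (g u)) && (tcol mu y == tcol mu u)}.
  apply: sigW; rewrite inE; case: ltnP => [lt_h|_]; last by exists u.
  rewrite -theightP in lt_h; have [y ry cy] := tcell_ex lt_h.
  by exists y; rewrite ry cy !eqxx.
pose phi u := sval (phi_ex u).
have phiP u : u \in B -> trow mu (phi u) = trow la (g u) /\ tcol mu (phi u) = tcol mu u.
  by rewrite /phi; case: (phi_ex u) => y /= /implyP H /H /andP[/eqP-> /eqP->].
have phi_inj : {in B &, injective phi}.
  move=> u v Bu Bv e; have [ru cu] := phiP u Bu; have [rv cv] := phiP v Bv.
  by apply: inj; rewrite -?cu -?cv -?ru -?rv e.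
have sum_h : \sum_u h u = nstat mu + \sum_u F u.
  rewrite /nstat -big_split /=; apply: eq_bigr => u _.
  by rewrite /F subnKC // ltnW // -theightP tcol_lt.
(* On [B], [h u] is [trow la (g u)] plus [F (phi u)]; off [B] it is at most [trow la (g u)]. *)
have sum_h_le : \sum_u h u <= nstat la + \sum_(y in phi @: B) F y.
  rewrite /nstat [X in _ <= X + _](reindex_inj (@perm_inj _ g)) /= big_imset //= (bigID (mem B)) /=.
  rewrite [X in _ <= X + _](bigID (mem B)) /= addnAC -big_split /=.
  apply: leq_add; apply: leq_sum => u.
    by move=> /phiP[ru cu]; rewrite /F /h ru cu -leq_subLR.
  by rewrite inE -leqNgt.
have F_gt0 y : 0 < F y by rewrite subn_gt0 -theightP tcol_lt.
(* As [nstat la <= nstat mu], the image of [B] must carry the whole sum of the positive function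
   [F], so it misses no cell. *)
have phiB : phi @: B = setT.
  apply/eqP; rewrite eqEsubset subsetT; apply/subsetP=> y _; apply/negPn/negP=> nBy.
  have: \sum_u F u <= \sum_(y in phi @: B) F y.
    by rewrite -(leq_add2l (nstat mu)) -sum_h (leq_trans sum_h_le) // leq_add2r.
  rewrite [X in X <= _ -> _](bigID (mem (phi @: B))) /= -[X in _ <= X -> _]addn0.
  rewrite leq_add2l leqn0 sum_nat_eq0 => /forallP/(_ y); rewrite nBy.
  by rewrite eqn0Ngt F_gt0.
have BT : B = setT.
  by apply/eqP; rewrite eqEcard subsetT -phiB leq_imset_card.
have {}phiP u := phiP u (eq_ind_r (fun D : {set _} => u \in D) (in_setT u) BT).
have {}phi_inj : injective phi by move=> u v; apply: phi_inj; rewrite BT.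
have eq_la : la = mu.
  apply: intpart_eq => i; rewrite -!card_trow.
  rewrite -(card_imset _ (@perm_inj _ (g^-1)%g)) -[LHS](card_imset _ phi_inj).
  apply: eq_card => y; rewrite inE; apply/imsetP/eqP.
    case=> u /imsetP[x /[!inE]/eqP<- ->] ->.
    by rewrite (phiP _).1 permKV.
  have: y \in phi @: B by rewrite phiB.
  case/imsetP=> u _ -> ; rewrite (phiP u).1 => ru; exists u => //.
  by apply/imsetP; exists (g u); rewrite ?inE ?ru ?permK.
split=> //; exists (perm phi_inj) => u; rewrite permE.
by rewrite (phiP u).1 (phiP u).2 eq_la.
Qed.

(** * Standard tableaux encoding croppings *)

Section StandardTableau.

Variables (m k : nat).
Implicit Types mu : intpart m.

Lemma tcol_ltm mu x : (tcol mu x < m).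
Proof.
apply: leq_trans (tcol_lt mu x) _; rewrite -card_trow.
by rewrite -[m in X in (_ <= X)]card_ord max_card.
Qed.

(* s x is the entry of the cell x, the cells being numbered row by row. *)
Definition std_tableau mu (s : 'S_m) : bool :=
  [forall x, (s x < m - k) ==> (trow mu x == 0)] &&
  [forall x, forall y, (trow mu x <= trow mu y) && (tcol mu x <= tcol mu y)
     ==> (s x <= s y)].

Lemma std_tableauP mu (s : 'S_m) :
  reflect ((forall x, (s x < m - k) -> trow mu x = 0) /\
           (forall x y, (trow mu x <= trow mu y) -> (tcol mu x <= tcol mu y) ->
              (s x <= s y)))
          (std_tableau mu s).
Proof.
apply: (iffP andP) => -[H1 H2]; split.
- by move=> x /(implyP (forallP H1 x)) /eqP.
- by move=> x y rxy cxy; have /forallP/(_ y)/implyP := forallP H2 x; apply; rewrite rxy.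
- by apply/forallP=> x; apply/implyP=> /H1->.
- by apply/'forall_forallP=> x y; apply/implyP=> /andP[]; apply: H2.
Qed.

End StandardTableau.

Definition cell_le N (c d : 'I_N * 'I_N) := (c.1 <= d.1) && (c.2 <= d.2).

Lemma diagram_closed N (D : {set 'I_N * 'I_N}) c d :
  is_diagram D -> d \in D -> cell_le c d -> c \in D.
Proof.
case/existsP=> n /existsP[mu /eqP->]; rewrite !inE => lt_d /andP[le1 le2].
exact: leq_ltn_trans le2 (leq_trans lt_d (width_leq mu le1)).
Qed.

Lemma crops_cells N (E D : {set 'I_N * 'I_N}) s : crops E D s ->
  [/\ uniq s, D =i [predU mem s & mem E] & {in s, forall c, c \notin E}].
Proof.
elim: s D => [|c s IH] D /=; first by move/eqP->; split=> // x; rewrite !inE.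
case/and3P=> Dc _ /IH[uniq_s eqD nEs].
have := negbT (setD11 c D); rewrite eqD inE /= negb_or => /andP[nsc nEc].
split=> [|x|x]; rewrite ?nsc //.
  have := eqD x; rewrite !inE; case: (eqVneq x c) => [-> _|_ /= ->] //.
by rewrite inE => /predU1P[->|/nEs].
Qed.

(** When [d] is removed, the shape is still a diagram containing [d], hence it contains every cell
    weakly above and to the left of [d]: such a cell goes later or never. *)
Lemma crops_order N (E D : {set 'I_N * 'I_N}) s c d : is_diagram D -> crops E D s ->
  d \in s -> cell_le c d -> (c \in E) || (c \in s) && (index d s <= index c s).
Proof.
move=> diagD cropD; have [_ eqD _] := crops_cells cropD; move: eqD.
elim: s D diagD cropD => //= b s IH D diagD /and3P[Db diagDb cropDb] eqD.
have [_ eqDb _] := crops_cells cropDb.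
rewrite inE => sd le_cd.
have [ebd|nbd] := eqVneq b d.
  have: c \in D by apply: diagram_closed le_cd => //; rewrite -ebd.
  by rewrite eqD !inE /= leq0n andbT orbC.
have {}sd : d \in s by move: sd; rewrite eq_sym (negPf nbd).
have := IH _ diagDb cropDb eqDb sd le_cd; case: (c \in E) => //= /andP[sc le_i].
have ncb : b != c.
  by apply: contraTneq sc => <-; have := negbT (setD11 b D); rewrite eqDb => /norP[].
by rewrite inE sc orbT (negPf ncb).
Qed.

Section CropTableau.

Variables (m k : nat) (mu : intpart m).
Hypothesis le_km : k <= m.

Lemma trow_ltm x : trow mu x < m.
Proof.
have lt_x : trow mu x < size (parts mu) by rewrite reshape_indexP // sumn_parts.
by apply: leq_trans lt_x _; rewrite size_map size_bseq.
Qed.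

Definition cell (x : 'I_m) : 'I_m * 'I_m :=
  (Ordinal (trow_ltm x), Ordinal (tcol_ltm mu x)).

Lemma cell_inj : injective cell.
Proof. by move=> x y [rxy cxy]; apply: tcell_inj rxy cxy. Qed.

Lemma cell_diagram x : cell x \in diagram m mu.
Proof. by rewrite inE; apply: tcol_lt. Qed.

Lemma diagram_cell c : c \in diagram m mu -> exists x, c = cell x.
Proof.
rewrite inE => lt_c; have [x rx cx] := tcell_ex lt_c.
by exists x; case: c lt_c rx cx => c1 c2 _ rx cx; congr (_, _); apply: val_inj.
Qed.

Lemma diagram_is_diagram : is_diagram (diagram m mu).
Proof. by apply/existsP; exists ord_max; apply/existsP; exists mu. Qed.

(** Entries record the removals backwards: the first cell removed gets m-1, the last one m-k, and
    the surviving row is filled with 0, ..., m-k-1. *)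
Definition crop_entry (s : seq ('I_m * 'I_m)) (x : 'I_m) : nat :=
  if cell x \in s then m - (index (cell x) s).+1 else tcol mu x.

Section Entry.

Variable s : seq ('I_m * 'I_m).
Hypothesis size_s : size s = k.
Hypothesis crop_s : crops (row_diagram m (m - k)) (diagram m mu) s.

Lemma crop_entry_row x :
  cell x \notin s -> trow mu x = 0 /\ tcol mu x < m - k.
Proof.
move=> nsx; have [_ eqD _] := crops_cells crop_s.
have := cell_diagram x; rewrite eqD inE /= (negPf nsx) /= inE /=.
by case/andP=> /eqP.
Qed.

Lemma crop_entry_lt x : crop_entry s x < m.
Proof. by rewrite /crop_entry; case: ifP => _; [have := ltn_ord x; lia | exact: tcol_ltm]. Qed.

Lemma crop_entry_small x : (crop_entry s x < m - k) = (cell x \notin s).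
Proof.
rewrite /crop_entry; case: ifPn => [sx|/crop_entry_row[]//].
by have := sx; rewrite -index_mem size_s; lia.
Qed.

Lemma crop_entry_inj : injective (fun x => Ordinal (crop_entry_lt x)).
Proof.
move=> x y [exy]; have := crop_entry_small x; rewrite exy crop_entry_small.
move: exy; rewrite /crop_entry; case: ifPn => sx; case: ifPn => sy // exy _.
  apply: cell_inj; have := sx; have := sy; rewrite -!index_mem size_s => ly lx.
  have exy' : index (cell x) s = index (cell y) s by lia.
  by rewrite -(nth_index (cell x) sx) -[RHS](nth_index (cell x) sy) exy'.
by apply: tcell_inj exy; rewrite !(crop_entry_row _).1.
Qed.

Definition crop_perm : 'S_m := perm crop_entry_inj.

Lemma crop_perm_std : std_tableau k mu crop_perm.
Proof.
apply/std_tableauP; split=> [x|x y rxy cxy]; rewrite !permE /=.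
  by rewrite crop_entry_small => /crop_entry_row[].
have le_xy : cell_le (cell x) (cell y) by rewrite /cell_le rxy.
have [sy|nsy] := boolP (cell y \in s).
  have [_ _ nE] := crops_cells crop_s.
  have lt_y : index (cell y) s < k by rewrite -size_s index_mem.
  rewrite /crop_entry sy.
  case/orP: (crops_order diagram_is_diagram crop_s sy le_xy) => [Ex|/andP[-> le_i]].
    have /negPf-> : cell x \notin s by apply: contraL Ex => /nE.
    by move: Ex; rewrite inE => /andP[_] /= lt_x; lia.
  by lia.
have [ry cy] := crop_entry_row nsy.
rewrite /crop_entry (negPf nsy); case: ifPn => // sx.
have [_ _ nE] := crops_cells crop_s.
have := nE _ sx; rewrite inE /=.
by have := rxy; rewrite ry leqn0 => ->; rewrite (leq_ltn_trans cxy cy).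
Qed.

End Entry.

(** The tableau determines the cropping, since the cell removed at step i (counted from 0) is the
    one with entry m-1-i. *)
Lemma Crop_leq_std : Crop mu k <= #|[set s | std_tableau k mu s]|.
Proof.
(* [crop_entry s] is known to be bijective only when [s] is a cropping; other tuples may fall back
   on the identity. *)
pose f (s : k.-tuple ('I_m * 'I_m)) : 'S_m :=
  odflt 1%g [pick p : 'S_m | [forall x, p x == crop_entry s x :> nat]].
have fE (s : k.-tuple _) (crop_s : crops (row_diagram m (m - k)) (diagram m mu) s) :
    f s = crop_perm (size_tuple s) crop_s.
  rewrite /f; case: pickP => [p /forallP pE|/(_ (crop_perm (size_tuple s) crop_s))].
    by apply/permP=> x; apply/val_inj; rewrite permE; apply/eqP/pE.
  by case/forallP=> x; rewrite permE.
rewrite /Crop -(@card_in_imset _ _ f).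
  apply: subset_leq_card; apply/subsetP=> _ /imsetP[s /[!inE] crop_s ->].
  by rewrite fE crop_perm_std.
move=> s t /[!inE] crop_s crop_t; rewrite !fE => eq_p.
have eq_f x : crop_entry s x = crop_entry t x.
  by have /permP/(_ x) := eq_p; rewrite !permE => -[].
(* The case k = 0 is set apart because the default cell [c0] used below requires m > 0. *)
apply/val_inj; have [k0|k_gt0] := posnP k.
  have nil_k (u : k.-tuple ('I_m * 'I_m)) : tval u = [::].
    by apply: size0nil; rewrite size_tuple.
  exact: etrans (nil_k s) (esym (nil_k t)).
have m_gt0 := leq_trans k_gt0 le_km.
pose c0 := cell (Ordinal m_gt0).
apply: (@eq_from_nth _ c0) => [|i]; first by rewrite !size_tuple.
move=> lt_i; have [_ eqD _] := crops_cells crop_s.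
have [x ex] : exists x, nth c0 s i = cell x.
  by apply: diagram_cell; rewrite eqD inE /= mem_nth.
have sx : cell x \in tval s by rewrite -ex mem_nth.
have tx : cell x \in tval t.
  rewrite -[_ \in _]negbK -(crop_entry_small (size_tuple t) crop_t) -eq_f.
  by rewrite (crop_entry_small (size_tuple s)) // negbK.
have := eq_f x; rewrite /crop_entry sx tx.
have [uniq_s _ _] := crops_cells crop_s.
have ix : index (cell x) s = i by rewrite -ex index_uniq.
have := tx; rewrite -index_mem size_tuple ix; rewrite size_tuple in lt_i => lt_x e.
have {}e : index (cell x) t = i by lia.
by rewrite ex -e nth_index.
Qed.

End CropTableau.

(** * Counting croppings *)

Section Removal.

Implicit Types (v w : nat -> nat) (i j n k : nat).

Definition dec i v j := v j - (j == i).
Definition inc i v j := v j + (j == i).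
Definition removable v i := v i.+1 < v i.
Definition addable v i := (i == 0) || (v i < v i.-1).

Variable N : nat.

(* Counts the ways to remove k corners, one after the other, from the diagram with
   row lengths v; [v 1 == 0] says that a single row is left. *)
Fixpoint nrem k v : nat :=
  if k is k'.+1 then \sum_(i < N.+1 | removable v i) nrem k' (dec i v)
  else v 1 == 0.

Lemma nrem_ext k v w : v =1 w -> nrem k v = nrem k w.
Proof.
elim: k v w => [|k IH] v w eq_vw /=; first by rewrite eq_vw.
apply: eq_big => [i|i _]; first by rewrite /removable !eq_vw.
by apply: IH => j; rewrite /dec eq_vw.
Qed.

(** Row lengths are functions on all of [nat], so that adding or removing a cell is a pointwise
    change; [v N = 0] and monotonicity make all rows from [N] on empty. *)
Definition is_ptn n v : Prop :=
  [/\ forall i, v i.+1 <= v i, v N = 0 & \sum_(i < N.+1) v i = n].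

Lemma sum_delta (i : 'I_N.+1) : \sum_(j < N.+1) (j == i :> nat) = 1.
Proof.
by rewrite (bigD1 i) //= eqxx big1 // => j /negPf; rewrite -val_eqE => ->.
Qed.

Lemma is_ptn_dec n v (i : 'I_N.+1) : is_ptn n.+1 v -> removable v i -> is_ptn n (dec i v).
Proof.
case=> mono vN sum_v rem; split=> [j||]; rewrite /dec.
- have := mono j; have := rem; rewrite /removable.
  by case: (eqVneq j i) => [->|]; case: eqP => //=; lia.
- by rewrite vN.
have : \sum_(j < N.+1) dec i v j + \sum_(j < N.+1) (j == i :> nat) = n.+1.
  rewrite -big_split -sum_v /=; apply: eq_bigr => j _; rewrite /dec subnK //.
  by case: eqP => // ->; apply: leq_trans rem.
by rewrite sum_delta addn1 => -[].
Qed.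

(** The two moves interact only if i = j+1, where both sides say that row j exceeds row j+1 by at
    least two. *)
Lemma add_rem_swap v i j : (forall l, v l.+1 <= v l) -> i != j ->
  addable v i && removable (inc i v) j = removable v j && addable (dec j v) i.
Proof.
move=> mono; rewrite /addable /removable /inc /dec.
case: i => [|i] /= nij; first by rewrite [j == 0]eq_sym (negPf nij) /= !addn0 andbT.
rewrite [j == i.+1]eq_sym (negPf nij) /= addn0 subn0 [i == j]eq_sym eqSS.
case: (eqVneq j i) => [->|_] /=; last by rewrite addn0 subn0 andbC.
by rewrite addn1 subn1 ltn_predRL.
Qed.

(** Row i+1 is addable exactly when row i is removable, and row 0 is always addable. Row [N], being
    empty, is not removable. *)
Lemma card_addable v : v N = 0 ->
  \sum_(i < N.+1) addable v i = (\sum_(i < N.+1) removable v i).+1.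
Proof.
move=> vN; rewrite big_ord_recl big_ord_recr /= [removable v N]/removable vN ltn0 addn0.
by rewrite add1n.
Qed.

(** This is the relation DU - UD = 1 of Young's lattice, applied n+1 times: adding then removing
    differs from removing then adding only through the diagonal terms, and [card_addable] counts
    these. *)
Lemma sum_addable n v : is_ptn n v ->
  \sum_(i < N.+1 | addable v i) nrem n.+1 (inc i v) = n.+1 * nrem n v.
Proof.
elim: n v => [|n IH] v ptn_v; have [mono vN sum_v] := ptn_v.
  have v0 (i : 'I_N.+1) : v i = 0.
    by apply/eqP; move/eqP: sum_v; rewrite sum_nat_eq0 => /forallP/(_ i).
  have v0' i : v i = 0.
    have := leq0n i; elim: i => [|i IHi] _; first exact: (v0 ord0).
    by apply/eqP; rewrite -leqn0 (leq_trans (mono i)) ?IHi.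
  rewrite (bigD1 ord0) //= [X in _ + X]big1 ?addn0 => [|i /andP[add_i ni]]; last first.
    by move: add_i; rewrite /addable !v0' ltnn orbF => /eqP i0; case/eqP: ni; apply: val_inj.
  rewrite mul1n (bigD1 ord0) /=; last by rewrite /removable /inc !v0'.
  rewrite [X in _ + X]big1 => [|i /andP[rem_i ni]]; last first.
    case/negP: ni; rewrite -val_eqE /=; move: rem_i; rewrite /removable /inc !v0'.
    by case: (val i).
  by rewrite addn0 /dec /inc /= !v0'.
pose F i j := nrem n.+1 (dec j (inc i v)).
(* Diagonal term: removing the cell just added gives back [v]. *)
have FD (i : 'I_N.+1) : addable v i -> nrem n.+2 (inc i v) =
    nrem n.+1 v + \sum_(j < N.+1 | removable (inc i v) j && (j != i)) F i j.
  move=> add_i; rewrite [LHS](bigD1 i) /=; last first.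
    rewrite /removable /inc eqxx; have := mono i; case: eqP; lia.
  congr (_ + _); apply: (nrem_ext n.+1) => l; rewrite /dec /inc addnK //.
rewrite (eq_bigr _ FD) big_split /= sum_nat_cond_const.
rewrite (exchange_big_dep (fun j : 'I_N.+1 => removable v j)) /=; last first.
  move=> i j add_i /andP[rem_j nij].
  have := add_rem_swap mono (i := i) (j := j); rewrite add_i rem_j eq_sym val_eqE nij.
  by move/(_ isT)/esym/andP => [].
(* Off the diagonal the removal can come first. The extra [nrem n.+1 v] is the missing term i = j,
   which completes the sum of the induction hypothesis for [dec j v]. *)
have swap (j : 'I_N.+1) : removable v j ->
    \sum_(i < N.+1 | addable v i && (removable (inc i v) j && (j != i))) F i j
      + nrem n.+1 v = n.+1 * nrem n (dec j v).
  move=> rem_j; rewrite -IH; last exact: is_ptn_dec.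
  rewrite [RHS](bigD1 j) /=; last first.
    rewrite /addable /dec eqxx; case: (val j) rem_j => //= j'; rewrite /removable.
    by have := mono j'; case: eqP; lia.
  rewrite addnC; congr (_ + _).
    apply: (nrem_ext n.+1) => l; rewrite /dec /inc; case: eqP => [->|] /=; last by lia.
    by move: rem_j; rewrite /removable; lia.
  apply: eq_big => [i|i /andP[add_i /andP[rem_ij nij]]].
    rewrite andbA; case: (eqVneq i j) => [->|nij]; rewrite ?andbF //.
    by rewrite !andbT add_rem_swap ?rem_j.
  apply: (nrem_ext n.+1) => l; rewrite /dec /inc; case: (eqVneq l i) => [->|_] /=; last by lia.
  have /negPf -> : i != j :> nat by rewrite eq_sym val_eqE.
  by lia.
have : \sum_(j < N.+1 | removable v j)
    (\sum_(i < N.+1 | addable v i && (removable (inc i v) j && (j != i))) F i j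
      + nrem n.+1 v) = n.+1 * nrem n.+1 v.
  by rewrite (eq_bigr _ swap) -big_distrr.
rewrite big_split /= sum_nat_cond_const => off.
have cardE (P : pred 'I_N.+1) : #|[set i | P i]| = \sum_i (P i : nat).
  by rewrite -sum1_card big_mkcond; apply: eq_bigr => i _; rewrite inE; case: (P i).
move: off; rewrite -!/(nrem n.+1 v).
rewrite !cardE card_addable //; set A := nrem n.+1 v; set B := \sum_(i < _) _.
set C := \sum_(i < _ | _) _ => off; nia.
Qed.

End Removal.

Lemma is_ptn_width N m (mu : intpart m) : m <= N -> is_ptn N m (width mu).
Proof.
move=> le_mN; have size_mu : size (parts mu) <= m by rewrite size_map size_bseq.
split=> [i||]; first exact: width_leq.
  by rewrite /width nth_default ?(leq_trans size_mu).
have le_sN : size (parts mu) <= N.+1 by rewrite (leq_trans size_mu) ?(leq_trans le_mN).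
rewrite -[RHS](sumn_parts mu) sumnE (big_nth 0) -(big_mkord xpredT) /=.
rewrite (big_cat_nat (n := size (parts mu))) //=.
rewrite [X in _ + X]big_nat_cond [X in _ + X]big1 ?addn0 //.
by move=> i /andP[/andP[le_i _] _]; rewrite /width nth_default.
Qed.

Lemma ptn_mono N n v i j : is_ptn N n v -> i <= j -> v j <= v i.
Proof.
case=> mono _ _ /subnK <-; elim: (j - i) => //= d IH.
exact: leq_trans (mono _) IH.
Qed.

Lemma ptn_eq0 N n v i : is_ptn N n v -> N <= i -> v i = 0.
Proof.
by move=> ptn_v le_i; apply/eqP; have := ptn_mono ptn_v le_i; case: ptn_v => _ -> _; rewrite leqn0.
Qed.

Lemma ptn_le N n v i : is_ptn N n v -> v i <= n.
Proof.
move=> ptn_v; have [lt_i|/ltnW le_i] := leqP i N; last by rewrite (ptn_eq0 ptn_v le_i).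
case: ptn_v => _ _ <-; rewrite -ltnS in lt_i.
by rewrite (bigD1 (Ordinal lt_i)) //= leq_addr.
Qed.

Lemma intpart_ex N n v : is_ptn N n v -> exists mu : intpart n, width mu =1 v.
Proof.
move=> ptn_v; have [mono vN sum_v] := ptn_v.
have [l /eqP vl min_l] : {l | v l == 0 & forall i, v i == 0 -> l <= i}.
  have ex0 : exists l, v l == 0 by exists N; apply/eqP.
  by case: (ex_minnP ex0) => l vl min_l; exists l.
have v_gt0 i : i < l -> 0 < v i.
  by move=> lt_i; rewrite lt0n; apply: contraTN lt_i => /min_l; rewrite -leqNgt.
have v_eq0 i : l <= i -> v i = 0.
  by move=> le_i; apply/eqP; rewrite -leqn0 -vl (ptn_mono ptn_v).
have le_lN : l <= N by apply: min_l; apply/eqP.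
pose s := mkseq v l.
have sumE : sumn s = \sum_(0 <= i < l) v i by rewrite sumnE big_map /index_iota subn0.
have sum_s : sumn s = n.
  rewrite -sum_v sumE -(big_mkord xpredT) /=.
  rewrite [RHS](big_cat_nat (n := l)) //= ?(leqW le_lN) //.
  rewrite [X in _ = _ + X]big_nat_cond [X in _ = _ + X]big1 ?addn0 ?subn0 //.
  by move=> i /andP[/andP[le_i _] _]; apply: v_eq0.
have size_s : size s <= n.
  rewrite -sum_s size_mkseq sumE -[X in X <= _]subn0.
  rewrite -[X in X <= _]muln1 -sum_nat_const_nat big_nat_cond [X in _ <= X]big_nat_cond.
  by apply: leq_sum => i /andP[/andP[_ /v_gt0]].
have ptn_s : is_intpart n s.
  rewrite /is_intpart sum_s eqxx andbT; apply/andP; split.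
    apply: (@homo_sorted _ _ v leq) (iota_sorted 0 l) => i j.
    exact: (ptn_mono ptn_v).
  by apply/allP=> _ /mapP[i + ->]; rewrite mem_iota => /andP[_ /v_gt0].
pose t := [seq inord x : 'I_n.+1 | x <- s].
have ts : map val t = s.
  rewrite -map_comp map_id_in // => _ /mapP[i _ ->] /=.
  by rewrite inordK // ltnS (ptn_le _ ptn_v).
have size_t : size t <= n by rewrite size_map.
have ptn_t : is_intpart n (map val (Bseq size_t)) by rewrite /= ts.
exists (Sub (Bseq size_t) ptn_t) => i.
rewrite /width /parts /= ts; case: (ltnP i l) => [lt_i|le_i]; first by rewrite nth_mkseq.
by rewrite nth_default ?size_mkseq // v_eq0.
Qed.

(** * Croppings as successive removals of corners *)

Section Corners.

Variable M : nat.

Definition cells (v : nat -> nat) : {set 'I_M * 'I_M} := [set c : 'I_M * 'I_M | c.2 < v c.1].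

Lemma is_diagram_cells n v : is_ptn M n v -> n <= M -> is_diagram (cells v).
Proof.
move=> ptn_v le_n; have [mu eq_mu] := intpart_ex ptn_v.
apply/existsP; exists (inord n); rewrite inordK ?ltnS //.
apply/existsP; exists mu; apply/eqP/setP=> c; rewrite !inE.
by rewrite -eq_mu.
Qed.

Lemma cells_dec n v (c : 'I_M * 'I_M) : is_ptn M n v -> removable v c.1 ->
  c.2 = (v c.1).-1 :> nat -> cells v :\ c = cells (dec c.1 v).
Proof.
case=> mono _ _ rem_c c2; apply/setP=> d; rewrite !inE /dec.
rewrite -pair_eqE /= -!val_eqE /= c2; move: rem_c; rewrite /removable.
by case: (eqVneq (val d.1) c.1) => [->|_] /=; lia.
Qed.

(** If a diagram remains, no other cell of the shape lies weakly below and to the right of [c];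
    testing the lower and the right neighbour shows that [c] ends a removable row. *)
Lemma corner_removable n v (c : 'I_M * 'I_M) : is_ptn M n v -> n <= M ->
  (c \in cells v) && is_diagram (cells v :\ c) =
  removable v c.1 && (c.2 == (v c.1).-1 :> nat).
Proof.
move=> ptn_v le_n; have [mono vM sum_v] := ptn_v.
apply/idP/idP=> [/andP[vc diag]|/andP[rem_c /eqP c2]]; last first.
  have lt_c : 0 < v c.1 by apply: leq_trans rem_c.
  rewrite inE c2 ltn_predL lt_c (cells_dec ptn_v) //=.
  case: n ptn_v le_n {sum_v} => [|n] ptn_v le_n.
    by have := ptn_le c.1 ptn_v; lia.
  have i_ltM : c.1 < M.+1 by apply: ltnW; rewrite ltnS.
  apply: (@is_diagram_cells n) (ltnW le_n); exact: (@is_ptn_dec M n v (Ordinal i_ltM)).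
have notc d : d \in cells v -> cell_le c d -> d = c.
  move=> vd le_cd; apply/eqP/negPn/negP=> ne_dc.
  have dd : d \in cells v :\ c by rewrite in_setD1 ne_dc.
  by have := diagram_closed diag dd le_cd; rewrite setD11.
rewrite inE in vc; have le_vM i : v i <= M by apply: leq_trans (ptn_le i ptn_v) le_n.
apply/andP; split.
  rewrite /removable ltn_neqAle mono andbT; apply/negP=> /eqP eq_v.
  have lt_i : c.1.+1 < M.
    rewrite ltnNge; apply/negP=> /(ptn_eq0 ptn_v); lia.
  have := notc (Ordinal lt_i, c.2); rewrite inE /cell_le /= eq_v => /(_ vc).
  by rewrite leqnSn leqnn => /(_ isT) /(congr1 (fun c => val c.1)) /=; lia.
rewrite eqn_leq; apply/andP; split; first by lia.
rewrite leqNgt; apply/negP=> lt_c2.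
have lt_j : c.2.+1 < M by have := le_vM c.1; lia.
have := notc (c.1, Ordinal lt_j); rewrite inE /cell_le /= leqnn leqnSn.
move=> /(_ _ isT); have -> : c.2.+1 < v c.1 by lia.
by move=> /(_ isT) /(congr1 (fun c => val c.2)) /=; lia.
Qed.

Lemma card_tuple_cons (T : finType) k (P : pred (seq T)) :
  #|[set s : k.+1.-tuple T | P s]| = \sum_c #|[set s : k.-tuple T | P (c :: s)]|.
Proof.
under eq_bigr do rewrite -sum1_card.
rewrite pair_big_dep /= -sum1_card.
rewrite (reindex (fun p : T * k.-tuple T => [tuple of p.1 :: p.2])) /=.
  by apply: eq_bigl => -[c s]; rewrite !inE.
exists (fun s => (thead s, [tuple of behead s])) => [[c s] _|s _].
  by congr (_, _); apply: val_inj.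
by rewrite [RHS]tuple_eta; apply: val_inj.
Qed.

End Corners.

(** Induction on the first removed cell. At the end r cells remain, and they form the single row of
    length r exactly when row 1 is empty, which is the base case of [nrem]. *)
Lemma crops_count M k r v : is_ptn M (r + k) v -> r + k <= M ->
  #|[set s : k.-tuple ('I_M * 'I_M) | crops (row_diagram M r) (cells M v) s]| = nrem M k v.
Proof.
elim: k v => [|k IH] v ptn_v le_M.
  have -> : [set s : 0.-tuple ('I_M * 'I_M) | crops (row_diagram M r) (cells M v) s]
      = if cells M v == row_diagram M r then setT else set0.
    by apply/setP=> s; rewrite inE tuple0 /=; case: ifP; rewrite ?in_setT ?in_set0.
  rewrite (_ : #|_| = (cells M v == row_diagram M r)); last first.
    by case: ifP; rewrite ?cards0 // cardsT card_tuple expn0.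
  congr (nat_of_bool _); rewrite addn0 in ptn_v le_M.
  have [mono vM sum_v] := ptn_v; apply/eqP/eqP=> [eq_c|v1].
    apply/eqP; rewrite -leqn0 leqNgt; apply/negP=> v1.
    have lt1 : 1 < M by rewrite ltnNge; apply/negP=> /(ptn_eq0 ptn_v); lia.
    have : (Ordinal lt1, Ordinal (ltnW lt1)) \in cells M v by rewrite inE.
    by rewrite eq_c inE.
  have v0 : v 0 = r.
    move: sum_v; rewrite big_ord_recl big1 ?addn0 // => i _.
    by apply/eqP; rewrite -leqn0 -v1 (ptn_mono ptn_v).
  apply/setP=> -[[[|i] lt_i] j]; rewrite !inE /= ?v0 //.
  by have := ptn_mono ptn_v (ltn0Sn i); rewrite v1 leqn0 => /eqP->.
rewrite (card_tuple_cons k (fun s => crops (row_diagram M r) (cells M v) s)) /=.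
case: M ptn_v le_M IH => [|M'] ptn_v le_M IH; first by rewrite addnS in le_M.
set M := M'.+1 in ptn_v le_M IH *.
pose corner (c : 'I_M * 'I_M) := removable v c.1 && (c.2 == (v c.1).-1 :> nat).
have cropE (c : 'I_M * 'I_M) :
    #|[set s : k.-tuple ('I_M * 'I_M) | [&& c \in cells M v, is_diagram (cells M v :\ c)
        & crops (row_diagram M r) (cells M v :\ c) s]]|
    = if corner c then nrem M k (dec c.1 v) else 0.
  have := corner_removable c ptn_v le_M; rewrite -/(corner c).
  case: ifP => [eq_c|_ e]; last first.
    apply/eqP; rewrite cards_eq0; apply/negPn/negP=> /set0Pn[s].
    by rewrite in_set => /and3P[vc diag _]; rewrite vc diag in e.
  have [rem_c /eqP c2] := andP eq_c; move=> /andP[-> ->].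
  have i_ltM : c.1 < M.+1 by apply: ltnW; rewrite ltnS.
  rewrite addnS in ptn_v le_M.
  rewrite (cells_dec ptn_v) // -IH ?(ltnW le_M) //.
  exact: (is_ptn_dec (i := Ordinal i_ltM)).
rewrite (eq_bigr _ (fun c _ => cropE c)) -big_mkcond.
(* Rows correspond to their last cells. The sum in [nrem] has one more row index, [M], but that row
   is empty and never removable. *)
pose h (i : 'I_M.+1) : 'I_M * 'I_M := (inord i, inord (v i).-1).
pose h' (c : 'I_M * 'I_M) : 'I_M.+1 := widen_ord (leqnSn M) c.1.
rewrite (reindex_onto h h') /=; last first.
  move=> c /andP[_ /eqP c2]; rewrite /h /h' /= -c2 !inord_val.
  by case: c {c2}.
have lt_iM (i : 'I_M.+1) : removable v i -> i < M.
  by move=> rem_i; rewrite ltnNge; apply/negP=> /(ptn_eq0 ptn_v) v0; rewrite /removable v0 in rem_i.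
apply: eq_big => [i|i /andP[_ /eqP hi]]; last first.
  by apply: nrem_ext => j; rewrite -[in RHS]hi.
apply/andP/idP=> [[/andP[rem_i _] /eqP hi]|rem_i]; first by rewrite -hi.
rewrite /corner /h /h' /= !inordK ?lt_iM //; last first.
  by have := ptn_le i ptn_v; have := rem_i; rewrite /removable; lia.
rewrite rem_i eqxx; split=> //; apply/eqP/val_inj => /=.
by rewrite inordK ?lt_iM.
Qed.

Lemma Crop_nrem m k (mu : intpart m) : k <= m -> Crop mu k = nrem m k (width mu).
Proof.
move=> le_km; have := is_ptn_width mu (leqnn m); rewrite -{2}(subnK le_km) => ptn_mu.
by rewrite -(crops_count ptn_mu) ?subnK.
Qed.

Definition one_row m j := if j == 0 then m else 0.

Lemma is_ptn_one_row N m : m <= N -> is_ptn N m (one_row m).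
Proof.
move=> le_m; split=> [i||]; rewrite /one_row //.
  by case: eqP le_m => // -> /[!leqn0]/eqP.
by rewrite big_ord_recl big1 // addn0.
Qed.

Lemma nrem_one_row N m : nrem N m (one_row m) = 1.
Proof.
elim: m => [|m IH] //; rewrite /= (bigD1 ord0) //= big1 ?addn0.
  by rewrite -IH; apply: nrem_ext => -[|j]; rewrite /dec /one_row /= ?subn1.
by case=> [[|i] lt_i] /andP[].
Qed.

(** * Double counting along the covers of Young's lattice *)

Section Covers.

Variables N m : nat.
Hypothesis lt_mN : m < N.
Implicit Types (nu : intpart m) (mu : intpart m.+1) (i : 'I_N.+1).

Let ptn_nu nu : is_ptn N m (width nu) := is_ptn_width nu (ltnW lt_mN).
Let ptn_mu mu : is_ptn N m.+1 (width mu) := is_ptn_width mu lt_mN.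

Definition covers i nu mu := [forall j : 'I_N.+1, width mu j == inc i (width nu) j].

Lemma coversP i nu mu : reflect (width mu =1 inc i (width nu)) (covers i nu mu).
Proof.
apply: (iffP forallP) => [eq_w j|eq_w j]; last by rewrite eq_w.
have [lt_j|le_j] := ltnP j N.+1; first exact/eqP/(eq_w (Ordinal lt_j)).
rewrite /inc (ptn_eq0 (ptn_mu mu)) ?(ptn_eq0 (ptn_nu nu)) ?(ltnW le_j) //.
by rewrite gtn_eqF // (leq_trans (ltn_ord i)).
Qed.

Lemma covers_removable i nu mu : covers i nu mu -> removable (width mu) i.
Proof.
by move/coversP=> eq_w; rewrite /removable !eq_w /inc eqxx gtn_eqF // addn0 addn1 ltnS width_leq.
Qed.

Lemma covers_dec i nu mu : covers i nu mu -> width nu =1 dec i (width mu).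
Proof. by move/coversP=> eq_w j; rewrite /dec eq_w /inc addnK. Qed.

Lemma covers_addable i nu mu : covers i nu mu -> addable (width nu) i.
Proof.
move/coversP=> eq_w; rewrite /addable; case: (val i) eq_w => [|i'] //= eq_w.
have := width_leq mu (leqnSn i'); rewrite !eq_w /inc eqxx [i' == _]ltn_eqF //.
by rewrite addn0 addn1.
Qed.

Lemma sum_covers_down i mu (X : intpart m -> nat) (Y : (nat -> nat) -> nat) :
    (forall nu, X nu = Y (width nu)) -> (forall v w, v =1 w -> Y v = Y w) ->
  \sum_(nu | covers i nu mu) X nu = if removable (width mu) i then Y (dec i (width mu)) else 0.
Proof.
move=> XY Yext; case: ifPn => [rem_i|nrem_i]; last first.
  by rewrite big1 // => nu /covers_removable rem_i; rewrite rem_i in nrem_i.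
have [nu0 eq_nu0] := intpart_ex (is_ptn_dec (ptn_mu mu) rem_i).
rewrite (big_pred1 nu0) ?XY => [|nu]; first exact: Yext.
apply/idP/eqP=> [/covers_dec eq_nu|->].
  by apply: intpart_eq => j; rewrite eq_nu eq_nu0.
apply/coversP=> j; rewrite /inc eq_nu0 /dec subnK //.
by case: eqP => // ->; apply: leq_trans rem_i.
Qed.

Lemma is_ptn_inc i nu : addable (width nu) i -> is_ptn N m.+1 (inc i (width nu)).
Proof.
move=> add_i; have [mono vN sum_v] := ptn_nu nu.
have lt_i : i < N.
  rewrite ltn_neqAle -ltnS ltn_ord andbT; apply: contraTneq add_i => ->.
  rewrite /addable (ptn_eq0 (is_ptn_width nu (leqnn m)) (i := N.-1)) ?ltn0 ?orbF; last by lia.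
  by rewrite -lt0n (leq_ltn_trans _ lt_mN).
split=> [j||]; rewrite /inc.
- have := mono j; move: add_i; rewrite /addable.
  by case: (eqVneq j.+1 i) => [<-|_]; case: eqP => //=; lia.
- by rewrite vN gtn_eqF.
by rewrite big_split /= sum_v sum_delta addn1.
Qed.

Lemma sum_covers_up i nu (X : intpart m.+1 -> nat) (Y : (nat -> nat) -> nat) :
    (forall mu, X mu = Y (width mu)) -> (forall v w, v =1 w -> Y v = Y w) ->
  \sum_(mu | covers i nu mu) X mu = if addable (width nu) i then Y (inc i (width nu)) else 0.
Proof.
move=> XY Yext; case: ifPn => [add_i|nadd_i]; last first.
  by rewrite big1 // => mu /covers_addable add_i; rewrite add_i in nadd_i.
have [mu0 eq_mu0] := intpart_ex (is_ptn_inc add_i).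
rewrite (big_pred1 mu0) ?XY => [|mu]; first exact: Yext.
apply/idP/eqP=> [/coversP eq_mu|->]; last exact/coversP.
by apply: intpart_eq => j; rewrite eq_mu eq_mu0.
Qed.

(** Double count the pairs of shapes differing by one cell: unfolding [nrem k.+1] goes down from
    [mu] to [nu], and summing [nrem m.+1] over the shapes above [nu] is [sum_addable]. *)
Lemma sum_nrem_step k :
  \sum_(mu : intpart m.+1) nrem N k.+1 (width mu) * nrem N m.+1 (width mu) =
  m.+1 * \sum_(nu : intpart m) nrem N k (width nu) * nrem N m (width nu).
Proof.
transitivity (\sum_(mu : intpart m.+1) \sum_(i < N.+1) \sum_(nu : intpart m | covers i nu mu)
                nrem N k (width nu) * nrem N m.+1 (width mu)).
  apply: eq_bigr => mu _; rewrite [nrem N k.+1 _]/= big_mkcond big_distrl /=.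
  apply: eq_bigr => i _; rewrite -big_distrl /=; congr (_ * _).
  by rewrite (sum_covers_down i mu (Y := nrem N k)) // => v w; apply: nrem_ext.
rewrite exchange_big /= (eq_bigr (fun i : 'I_N.+1 =>
    \sum_(nu : intpart m) \sum_(mu : intpart m.+1 | covers i nu mu)
                nrem N k (width nu) * nrem N m.+1 (width mu))); last first.
  by move=> i _; apply: (exchange_big_dep xpredT).
rewrite exchange_big big_distrr /=; apply: eq_bigr => nu _.
rewrite mulnCA -(sum_addable (ptn_nu nu)) [in RHS]big_mkcond big_distrr /=.
apply: eq_bigr => i _; rewrite -big_distrr /=; congr (_ * _).
by rewrite (sum_covers_up i nu (Y := nrem N m.+1)) // => v w; apply: (nrem_ext N m.+1).
Qed.

End Covers.

Lemma sum_nrem N m k : k <= m -> m <= N ->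
  (\sum_(mu : intpart m) nrem N k (width mu) * nrem N m (width mu)) * (m - k)`! = m`!.
Proof.
elim: k m => [|k IH] m le_k le_m; last first.
  case: m le_k le_m => // m le_k lt_m; rewrite subSS sum_nrem_step // factS -(IH m) ?(ltnW lt_m) //.
  by rewrite mulnA.
have [mu0 eq_mu0] := intpart_ex (is_ptn_one_row le_m).
(* For k = 0 the first factor is the indicator of the one-row shape, which has a single complete
   removal. *)
rewrite subn0 (bigD1 mu0) //= big1 ?addn0 => [|mu ne_mu].
  by rewrite eq_mu0 (nrem_ext N m eq_mu0) nrem_one_row !mul1n.
have [v1|//] := eqVneq (width mu 1) 0.
have ptn_mu := is_ptn_width mu le_m; have [_ _ sum_mu] := ptn_mu.
case/eqP: ne_mu; apply: intpart_eq => j; rewrite eq_mu0 /one_row.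
have pos_0 i : 0 < i -> width mu i = 0.
  by move=> i_gt0; apply/eqP; rewrite -leqn0 -v1 (ptn_mono ptn_mu).
case: eqP => [->|/eqP]; last by rewrite -lt0n => /pos_0.
move: sum_mu; rewrite big_ord_recl big1 ?addn0 // => i _; exact: pos_0.
Qed.

Lemma sum_Crop m k : k <= m ->
  (\sum_(mu : intpart m) Crop mu k * Crop mu m) * (m - k)`! = m`!.
Proof.
move=> le_km; rewrite -(sum_nrem le_km (leqnn m)); congr (_ * _).
by apply: eq_bigr => mu _; rewrite !Crop_nrem.
Qed.

(** A nonempty shape has a removable row: otherwise all rows would be as long as the empty row
    [N]. *)
Lemma nrem_gt0 N n v : is_ptn N n v -> 0 < nrem N n v.
Proof.
elim: n v => [|n IH] v ptn_v /=; have [mono vN sum_v] := ptn_v.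
  by have := ptn_le 1 ptn_v; rewrite leqn0 => ->.
have [i rem_i] : exists i : 'I_N.+1, removable v i.
  apply/existsP; apply: contraPT sum_v; rewrite negb_exists => /forallP none.
  have v0 j : v j = v 0.
    elim: j => // j <-; apply/eqP; rewrite eqn_leq mono /=.
    have [lt_j|le_j] := ltnP j N.+1; first by rewrite leqNgt; apply: (none (Ordinal lt_j)).
    by rewrite (ptn_eq0 ptn_v (ltnW le_j)).
  by rewrite big1 // => j _; rewrite v0 -(v0 N).
rewrite (bigD1 i) //= ltn_addr // IH //; exact: is_ptn_dec.
Qed.

Lemma Crop_gt0 m (mu : intpart m) : 0 < Crop mu m.
Proof. by rewrite Crop_nrem // nrem_gt0 //; apply: is_ptn_width. Qed.

(** List [A] followed by its complement, do the same for [B], and match the two lists. *)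
Lemma perm_imset_ex (T : finType) (A B : {set T}) :
  #|A| = #|B| -> exists g : {perm T}, g @: A = B.
Proof.
move=> eqAB; pose s (C : {set T}) := enum C ++ enum (~: C).
have mem_s C x : x \in s C by rewrite mem_cat !mem_enum inE orbN.
have uniq_s C : uniq (s C).
  rewrite cat_uniq !enum_uniq andbT /=; apply/hasPn=> x.
  by rewrite !mem_enum inE.
have size_s C : size (s C) = #|T| by rewrite size_cat -!cardE cardsC.
pose f x := nth x (s B) (index x (s A)).
have lt_i x : index x (s A) < size (s B) by rewrite size_s -(size_s A) index_mem.
have f_inj : injective f.
  move=> x y; rewrite /f (set_nth_default x y) // => /eqP.
  rewrite nth_uniq // => /eqP eq_i.
  by rewrite -(nth_index x (mem_s A x)) eq_i nth_index.
exists (perm f_inj); apply/eqP.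
rewrite eqEcard card_imset ?eqAB ?leqnn ?andbT; last exact: perm_inj.
apply/subsetP=> _ /imsetP[x Ax ->]; rewrite permE /f -mem_enum nth_cat.
have lt_x : index x (s A) < size (enum A) by rewrite index_cat mem_enum Ax index_mem mem_enum.
by rewrite -cardE -eqAB cardE lt_x mem_nth // -cardE -eqAB cardE.
Qed.

Local Open Scope ring_scope.

(** * Operators of class functions on the regular representation *)

Lemma char_poly_block n1 n2 (A : 'M[algC]_n1) (B : 'M_n2) :
  char_poly (block_mx A 0 0 B) = char_poly A * char_poly B.
Proof. by rewrite /char_poly char_block_diag_mx det_ublock. Qed.

Lemma char_poly_scalar n (a : algC) : char_poly (a%:M : 'M_n) = ('X - a%:P) ^+ n.
Proof.
rewrite char_poly_trig ?scalar_mx_is_trig //.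
under eq_bigr do rewrite mxE eqxx mulr1n.
by rewrite prodr_const card_ord.
Qed.

Section ClassSum.

Variables (gT : finGroupType) (G : {group gT}) (f : gT -> algC).

Definition fun_op n (rG : mx_representation algC G n) : 'M_n :=
  \sum_(x in G) f x *: rG x.

(** The intertwiner conjugates one operator into the other; its determinant is cancelled in the
    polynomial ring, so no inverse is formed. *)
Lemma char_poly_fun_op_rsim n1 n2 (rG1 : mx_representation algC G n1)
    (rG2 : mx_representation algC G n2) :
  mx_rsim rG1 rG2 -> char_poly (fun_op rG1) = char_poly (fun_op rG2).
Proof.
case=> B eq_n; case: n2 / eq_n rG2 B => rG2 B freeB homB.
have sAB : fun_op rG1 *m B = B *m fun_op rG2.
  rewrite mulmx_suml mulmx_sumr; apply: eq_bigr => x Gx.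
  by rewrite -scalemxAl -scalemxAr homB.
have detB : \det (map_mx polyC B) != 0.
  rewrite det_map_mx polyC_eq0 -unitfE.
  by rewrite -[_ \is a _]/(B \in unitmx) -row_free_unit.
apply: (mulIf detB); rewrite /char_poly -det_mulmx mulrC -det_mulmx.
congr (\det _); rewrite /char_poly_mx mulmxBl mulmxBr.
by rewrite -!map_mxM sAB scalar_mxC.
Qed.

Lemma char_poly_fun_op_dsum (I : finType) (rG : I -> representation algC G) :
  char_poly (fun_op (\big[dadd_grepr/grepr0]_i rG i)) =
    \prod_i char_poly (fun_op (rG i)).
Proof.
pose P (r : representation algC G) := char_poly (fun_op r).
rewrite -[LHS]/(P _) (big_morph P (op1 := *%R) (id1 := 1)) // => [r1 r2|].
  rewrite /P -char_poly_block /fun_op; congr char_poly.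
  transitivity (\sum_(x in G) block_mx (f x *: r1 x) 0 0 (f x *: r2 x)).
    by apply: eq_bigr => x _; rewrite scale_block_mx !scaler0.
  elim/big_rec3: _ => [|x B2 B1 B Gx ->]; first by rewrite block_mx_const.
  by rewrite add_block_mx !addr0.
by rewrite /P /char_poly det_mx00.
Qed.

Hypothesis f_class : forall x y, x \in G -> y \in G -> f (x ^ y)%g = f x.

(** By Schur's lemma the operator, which commutes with the group, is a scalar; its trace gives the
    value. *)
Lemma fun_op_irr (i : Iirr G) :
  fun_op 'Chi_i = ((\sum_(x in G) f x * 'chi_i x) / 'chi_i 1%g)%:M.
Proof.
have scal : is_scalar_mx (fun_op 'Chi_i).
  apply: (@mx_abs_irr_cent_scalar _ _ _ _ 'Chi_i).
    by apply: groupC; apply: socle_irr.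
  apply/centgmxP=> y Gy; rewrite mulmx_suml mulmx_sumr.
  rewrite [RHS](reindex_inj (conjg_inj y)) /=.
  apply: eq_big => [x|x Gx]; first by rewrite groupJr.
  by rewrite f_class // -scalemxAl -scalemxAr -!repr_mxM ?groupJ // conjgC.
case/is_scalar_mxP: scal => a ea; rewrite ea; congr _%:M.
have nz : 'chi_i 1%g != 0 := irr1_neq0 i.
apply: (mulIf nz); rewrite divfK // -irrRepr cfRepr1 mulr_natr.
have := congr1 mxtrace ea; rewrite mxtrace_scalar raddf_sum /= => <-.
by apply: eq_bigr => x Gx; rewrite mxtraceZ cfunE Gx mulr1n.
Qed.

(** The regular representation contains each irreducible as often as its degree, and each copy
    contributes a scalar block of that same size, whence the square. *)
Lemma char_poly_fun_op_regular :
  char_poly (fun_op (regular_repr algC G)) =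
  \prod_(i : Iirr G) ('X - ((\sum_(x in G) f x * 'chi_i x) / 'chi_i 1%g)%:P)
     ^+ (Num.trunc ('chi_i 1%g) ^ 2).
Proof.
pose d (i : Iirr G) := Num.trunc ('chi_i 1%g).
have dE i : 'chi_i 1%g = (d i)%:R by rewrite /d truncK ?Cnat_irr1.
have rsim : mx_rsim (regular_repr algC G)
    (\big[dadd_grepr/grepr0]_i muln_grepr (Representation 'Chi_i) (d i)).
  apply: cfRepr_inj; rewrite cfReprReg cfReg_sum cfRepr_dsum.
  by apply: eq_bigr => i _; rewrite cfRepr_muln irrRepr dE scaler_nat.
rewrite (char_poly_fun_op_rsim rsim) char_poly_fun_op_dsum.
apply: eq_bigr => i _; rewrite char_poly_fun_op_dsum /= prodr_const card_ord.
rewrite fun_op_irr char_poly_scalar -exprM; congr (_ ^+ _).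
have: 'chi_i 1%g = (irr_degree (socle_of_Iirr i))%:R.
  by rewrite -{1}irrRepr cfRepr1.
by rewrite -/(d i) dE => /eqP; rewrite eqr_nat => /eqP <-; rewrite -mulnn.
Qed.

End ClassSum.

Lemma char_poly_cast n n' (e : n = n') (A : 'M[algC]_n) :
  char_poly (castmx (e, e) A) = char_poly A.
Proof. by case: n' / e; rewrite castmx_id. Qed.

(** In the row of x, the matrix of y has its only 1 in the column of xy, so a column z picks out y =
    x^-1 z. *)
Lemma fun_op_regularE (gT : finGroupType) (G : {group gT}) (f : gT -> algC) i j :
  fun_op f (regular_repr algC G) i j = f ((enum_val i)^-1 * enum_val j)%g.
Proof.
have Gi := enum_valP i; have Gj := enum_valP j.
have Gij : ((enum_val i)^-1 * enum_val j)%g \in G by rewrite groupM ?groupV.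
rewrite summxE (bigD1 _ Gij) /= big1 => [|x /andP[Gx nx]].
  by rewrite !mxE mulKVg gring_valK !eqxx mulr1 addr0.
rewrite !mxE eqxx /=; case: eqP => [ej|]; last by rewrite mulr0.
case/eqP: nx; apply: (mulgI (enum_val i)); rewrite mulKVg.
by rewrite [in RHS]ej gring_indexK ?groupM.
Qed.

Lemma char_poly_ABin m k :
  char_poly (ABin m k) =
  char_poly (fun_op (fun s : 'S_m => 'C(nfix s, k)%:R)
                    (regular_repr algC [set: 'S_m]%G)).
Proof.
have e : #|{: 'S_m}| = #|[set: 'S_m]| by rewrite cardsT.
rewrite -(char_poly_cast e); congr char_poly; apply/matrixP=> i j.
rewrite castmxE mxE fun_op_regularE.
have ev u : enum_val (cast_ord (esym e) u) = enum_val u.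
  by rewrite !(enum_val_nth 1%g) enum_setT enumT.
by rewrite !ev.
Qed.

(** * Young symmetrizers *)

Section Adjoint.

Definition adj n (A : 'M[algC]_n) : 'M[algC]_n := map_mx Num.conj A^T.

Lemma adjM n (A B : 'M[algC]_n) : adj (A *m B) = adj B *m adj A.
Proof. by rewrite /adj trmx_mul map_mxM. Qed.

Lemma adjK n : involutive (@adj n).
Proof. by move=> A; apply/matrixP=> i j; rewrite !mxE conjCK. Qed.

Lemma adjD n : {morph @adj n : A B / A + B}.
Proof. by move=> A B; rewrite /adj linearD map_mxD. Qed.

Lemma adj0 n : @adj n 0 = 0.
Proof. by rewrite /adj trmx0 map_mx0. Qed.

Lemma adjZ n a (A : 'M[algC]_n) : adj (a *: A) = a^* *: adj A.
Proof. by rewrite /adj linearZ map_mxZ. Qed.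

(** The diagonal entries of the product are the squared norms of the rows of [A]. *)
Lemma mulmx_adj_eq0 n (A : 'M[algC]_n) : (A *m adj A == 0) = (A == 0).
Proof.
apply/eqP/eqP=> [AA|->]; last by rewrite mul0mx.
apply/matrixP=> i j; apply/eqP; rewrite mxE -normr_eq0 -sqrf_eq0 normCK.
have /matrixP/(_ i i) := AA; rewrite !mxE => /eqP.
rewrite psumr_eq0 => [|k _]; last by rewrite !mxE mul_conjC_ge0.
by move/allP/(_ j (mem_index_enum _)); rewrite !mxE.
Qed.

End Adjoint.

Section YoungSymmetrizer.

Variable m : nat.
Local Notation G := [set: 'S_m]%G.
Local Notation rG := (regular_repr algC G).
Local Notation EG := (enveloping_algebra_mx rG).
Implicit Types (la mu : intpart m) (p q : 'S_m).

Lemma adj_regular (x : 'S_m) : adj (rG x) = rG x^-1%g.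
Proof.
apply/matrixP=> i j; rewrite !mxE !eqxx /= conjC_nat; congr (nat_of_bool _)%:R.
rewrite -!(inj_eq (can_inj (@gring_valK _ G))) !gring_indexK ?inE //.
by rewrite eq_sym -(inj_eq (mulIg x^-1%g)) mulgK eq_sym.
Qed.

Lemma adj_envelop A : (A \in EG)%MS -> (adj A \in EG)%MS.
Proof.
case/envelop_mxP=> a ->; rewrite (big_morph _ (@adjD _) (@adj0 _)) linear_sum.
apply: summx_sub => x _; rewrite adjZ adj_regular linearZ scalemx_sub //.
by rewrite envelop_mx_id ?inE.
Qed.

Definition row_sym la := \sum_(p in row_group la) rG p.
Definition col_sym mu := \sum_(q in col_group mu) (-1) ^+ q *: rG q.
Definition ysym mu := col_sym mu *m row_sym mu.

Lemma gring_row_regular (x : 'S_m) : gring_row (rG x) = delta_mx 0 (gring_index G x).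
Proof. by rewrite /gring_row rowK gring_indexK ?inE // mul1g. Qed.

(** [gring_row] evaluates an operator of the enveloping algebra at the identity, so computations
    with [ysym] transfer to the vector generating the Specht module. *)
Lemma young_symmetrizerE mu : young_symmetrizer mu = gring_row (ysym mu).
Proof.
rewrite /young_symmetrizer exchange_big /ysym mulmx_suml linear_sum /=.
apply: eq_bigr => q _; rewrite -scalemxAl mulmx_sumr linearZ /= linear_sum scaler_sumr /=.
by apply: eq_bigr => p _; rewrite -repr_mxM ?inE // gring_row_regular.
Qed.

Lemma row_groupP la (p : 'S_m) : reflect (forall x, trow la (p x) = trow la x) (p \in row_group la).
Proof. by rewrite inE; apply: (iffP forallP) => H x; apply/eqP/H. Qed.

Lemma col_groupP mu (q : 'S_m) : reflect (forall x, tcol mu (q x) = tcol mu x) (q \in col_group mu).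
Proof. by rewrite inE; apply: (iffP forallP) => H x; apply/eqP/H. Qed.

Lemma row_groupMl la p p' : p \in row_group la ->
  (p * p' \in row_group la)%g = (p' \in row_group la).
Proof.
move/row_groupP=> Rp; apply/row_groupP/row_groupP=> H x; last by rewrite permM H.
by rewrite -[x in LHS](permKV p) -permM H -[in RHS](permKV p x) Rp.
Qed.

Lemma row_groupV la p : (p^-1 \in row_group la)%g = (p \in row_group la).
Proof. by apply/row_groupP/row_groupP=> H x; rewrite -[in LHS]H ?permK ?permKV. Qed.

Lemma col_groupM mu q q' : q \in col_group mu ->
  (q' * q \in col_group mu)%g = (q' \in col_group mu).
Proof.
move/col_groupP=> Rp; apply/col_groupP/col_groupP=> H x; last by rewrite permM Rp.
by rewrite -Rp -permM H.
Qed.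

Lemma col_groupV mu q : (q^-1 \in col_group mu)%g = (q \in col_group mu).
Proof. by apply/col_groupP/col_groupP=> H x; rewrite -[in LHS]H ?permK ?permKV. Qed.

Lemma row_symM la p : p \in row_group la -> rG p *m row_sym la = row_sym la.
Proof.
move=> Rp; rewrite mulmx_sumr [RHS](reindex_inj (mulgI p)) /=.
by apply: eq_big => x; rewrite ?row_groupMl // -repr_mxM ?inE.
Qed.

Lemma col_symM mu q : q \in col_group mu -> col_sym mu *m rG q = (-1) ^+ q *: col_sym mu.
Proof.
move=> Cq; rewrite mulmx_suml scaler_sumr [RHS](reindex_inj (mulIg q)) /=.
apply: eq_big => x; rewrite ?col_groupM // => _.
rewrite -scalemxAl -repr_mxM ?inE // scalerA; congr (_ *: _).
by rewrite odd_permM signr_addb mulrCA -signr_addb addbb mulr1.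
Qed.

Lemma adj_row_sym la : adj (row_sym la) = row_sym la.
Proof.
rewrite (big_morph _ (@adjD _) (@adj0 _)) /row_sym [RHS](reindex_inj invg_inj) /=.
by apply: eq_big => p; rewrite ?row_groupV // adj_regular.
Qed.

Lemma adj_col_sym mu : adj (col_sym mu) = col_sym mu.
Proof.
rewrite (big_morph _ (@adjD _) (@adj0 _)) /col_sym [RHS](reindex_inj invg_inj) /=.
apply: eq_big => q; rewrite ?col_groupV // => _.
by rewrite adjZ adj_regular odd_permV rmorph_sign.
Qed.

(** If [u], [v] share a column of [mu] while [g u], [g v] share a row of [la], a transposition moved
    through [g] is absorbed with sign -1 on the left and +1 on the right, so the product vanishes.
    Otherwise [tableau_match] applies. *)
Lemma col_row_sym_neq0 la mu g :
    (nstat la <= nstat mu)%N -> col_sym mu *m rG g *m row_sym la != 0 ->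
  la = mu /\ exists q p, [/\ q \in col_group mu, p \in row_group mu & g = (q * p)%g].
Proof.
move=> le_n nz; have [|eq_la [q qP]] := tableau_match (g := g) le_n.
  move=> u v cuv ruv; apply/eqP/negPn/negP=> neq_uv; case/eqP: nz.
  have Ct : tperm u v \in col_group mu.
    by apply/col_groupP=> x; case: tpermP => // ->.
  have Rt : tperm (g u) (g v) \in row_group la.
    by apply/row_groupP=> x; case: tpermP => // ->.
  have eq_t : (tperm u v * g = g * tperm (g u) (g v))%g.
    by rewrite -tpermJ conjgC.
  set X := _ *m _; suff: (2%:R : algC) *: X = 0.
    by move/eqP; rewrite scaler_eq0 pnatr_eq0 => /eqP.
  rewrite scaler_nat mulr2n {1}/X -(row_symM Rt) mulmxA -(mulmxA _ (rG g)) -repr_mxM ?inE //.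
  rewrite -eq_t repr_mxM ?inE // mulmxA col_symM // odd_tperm neq_uv expr1.
  by rewrite scaleN1r !mulNmx addNr.
split=> //; exists q, (q^-1 * g)%g; rewrite mulKVg; split=> //.
  by apply/col_groupP=> u; case: (qP u).
apply/row_groupP=> w; rewrite permM -[in RHS](permKV q w).
by case: (qP (q^-1%g w)).
Qed.

Lemma mem_row_sym la : (row_sym la \in EG)%MS.
Proof. by rewrite linear_sum summx_sub // => x _; rewrite envelop_mx_id ?inE. Qed.

Lemma mem_col_sym mu : (col_sym mu \in EG)%MS.
Proof.
rewrite linear_sum summx_sub // => x _.
by rewrite linearZ scalemx_sub // envelop_mx_id ?inE.
Qed.

Lemma mem_ysym mu : (ysym mu \in EG)%MS.
Proof. by rewrite envelop_mxM ?mem_row_sym ?mem_col_sym. Qed.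

(** By linearity [Z] may be a group element; then the product vanishes or the element factors as q *
    p, whose factors are absorbed up to sign. *)
Lemma col_row_sym_ysym mu Z :
  (Z \in EG)%MS -> exists k, col_sym mu *m Z *m row_sym mu = k *: ysym mu.
Proof.
case/envelop_mxP=> z ->.
have ex g : {k | col_sym mu *m rG g *m row_sym mu == k *: ysym mu}.
  apply: sigW; have [/eqP->|nz] := boolP (col_sym mu *m rG g *m row_sym mu == 0).
    by exists 0; rewrite scale0r.
  have [_ [q [p [Cq Rp ->]]]] := col_row_sym_neq0 (leqnn _) nz.
  exists ((-1) ^+ q); rewrite repr_mxM ?inE // mulmxA col_symM // -mulmxA row_symM //.
  by apply/eqP; rewrite -scalemxAl.
exists (\sum_g z g * sval (ex g)); rewrite [col_sym mu *m _]mulmx_sumr.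
rewrite [_ *m row_sym mu]mulmx_suml scaler_suml.
apply: eq_big => [g|g _]; first by rewrite inE.
rewrite -scalemxAr -scalemxAl -scalerA; congr (_ *: _).
by case: (ex g) => k /= /eqP.
Qed.

Lemma row_col_group1 mu p q :
  p \in row_group mu -> q \in col_group mu -> (q * p = 1)%g -> q = 1%g.
Proof.
move=> /row_groupP Rp /col_groupP Cq qp1; apply/permP=> x; rewrite perm1.
apply: tcell_inj (Cq x).
by rewrite -Rp -permM qp1 perm1.
Qed.

(** The coefficient of the identity is 1, since q * p = 1 forces both factors to preserve rows and
    columns. *)
Lemma young_symmetrizer_neq0 mu : young_symmetrizer mu != 0.
Proof.
suff e1 : young_symmetrizer mu 0 (gring_index G 1) = 1.
  by apply/eqP=> e0; move/eqP: e1; rewrite e0 mxE eq_sym oner_eq0.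
have R1 : 1%g \in row_group mu by apply/row_groupP=> x; rewrite perm1.
have C1 : 1%g \in col_group mu by apply/col_groupP=> x; rewrite perm1.
have eq1 (x : 'S_m) : (gring_index G 1 == gring_index G x) = (x == 1%g).
  by rewrite -(inj_eq (can_inj (@gring_valK _ G))) !gring_indexK ?inE // eq_sym.
rewrite summxE (bigD1 _ R1) /= summxE (bigD1 _ C1) /= !big1 ?addr0.
- by rewrite !mxE eq1 mulg1 !eqxx odd_perm1 mulr1.
- move=> p /andP[Rp np]; rewrite summxE big1 // => q Cq; rewrite !mxE eqxx eq1.
  case: eqP => [qp1|]; last by rewrite mulr0.
  have q1 := row_col_group1 Rp Cq qp1.
  by case/eqP: np; rewrite -qp1 q1 mul1g.
- move=> q /andP[Cq nq]; rewrite !mxE eqxx eq1 mulg1 (negPf nq).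
  by rewrite mulr0.
Qed.

(* With A = ysym mu *m X, the matrix W = A A^* is nonzero Hermitian, so
   0 != W W = (W *m ysym mu) *m _, while W *m ysym mu is a multiple of ysym mu. *)
Lemma young_symmetrizer_return mu X :
    (X \in EG)%MS -> young_symmetrizer mu *m X != 0 ->
  exists2 Y, (Y \in EG)%MS &
    exists2 k, k != 0 & young_symmetrizer mu *m X *m (Y *m ysym mu) = k *: young_symmetrizer mu.
Proof.
move=> EX; rewrite young_symmetrizerE -gring_row_mul => nzA.
set A := ysym mu *m X in nzA *.
have EA : (A \in EG)%MS by rewrite envelop_mxM ?mem_ysym.
have {}nzA : A != 0 by apply: contraNneq nzA => ->; rewrite linear0.
have nzW : A *m adj A != 0 by rewrite mulmx_adj_eq0.
have nzWW : (A *m adj A) *m (A *m adj A) != 0.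
  by have := mulmx_adj_eq0 (A *m adj A); rewrite (adjM A) adjK => ->.
exists (adj A); first exact: adj_envelop.
have [|k Wk] := @col_row_sym_ysym mu (row_sym mu *m (X *m adj A) *m col_sym mu).
  by rewrite !envelop_mxM ?mem_row_sym ?mem_col_sym ?adj_envelop.
have {}Wk : A *m (adj A *m ysym mu) = k *: ysym mu by rewrite -Wk /A /ysym !mulmxA.
exists k; last by rewrite -gring_row_mul Wk linearZ.
apply: contraNneq nzWW => k0.
rewrite -[A *m adj A *m _]/(A *m adj A *m (ysym mu *m X *m adj A)).
have -> : A *m adj A *m (ysym mu *m X *m adj A) = A *m (adj A *m ysym mu) *m (X *m adj A).
  by rewrite !mulmxA.
by rewrite Wk k0 scale0r mul0mx.
Qed.

(** A nonzero vector of a submodule can be carried back to a nonzero multiple of the generator by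
    [young_symmetrizer_return]. *)
Lemma specht_simple mu : mxsimple rG (cyclic_mx rG (young_symmetrizer mu)).
Proof.
split; first exact: cyclic_mx_module.
  by rewrite cyclic_mx_eq0 young_symmetrizer_neq0.
move=> U modU sUV nzU; apply: cyclic_mx_sub => //.
have [X EX eX] := cyclic_mxP (submx_trans (nz_row_sub U) sUV).
have [||Y EY [k nzk eY]] := @young_symmetrizer_return mu X => //.
  by rewrite -eX nz_row_eq0.
rewrite -(scalerK nzk (young_symmetrizer mu)) -eY -eX scalemx_sub //.
by rewrite (mxmodule_envelop modU) ?nz_row_sub // envelop_mxM ?mem_ysym.
Qed.

(** The inner factor [row_sym la *m Z *m col_sym mu] is nonzero; taking adjoints exchanges the two
    symmetrizers and reaches the form handled by [col_row_sym_neq0]. *)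
Lemma ysym_mul_neq0 la mu Z : (Z \in EG)%MS ->
  (nstat la <= nstat mu)%N -> ysym la *m Z *m ysym mu != 0 -> la = mu.
Proof.
move=> EZ le_n nz.
have {nz}: row_sym la *m Z *m col_sym mu != 0.
  apply: contraNneq nz => e.
  have -> : ysym la *m Z *m ysym mu
          = col_sym la *m (row_sym la *m Z *m col_sym mu) *m row_sym mu.
    by rewrite /ysym !mulmxA.
  by rewrite e mulmx0 mul0mx.
move=> nz; have {nz}: col_sym mu *m adj Z *m row_sym la != 0.
  apply: contraNneq nz => e; rewrite -[X in X == 0]adjK.
  rewrite [adj (row_sym la *m Z *m _)]adjM [adj (row_sym la *m Z)]adjM.
  by rewrite adj_row_sym adj_col_sym mulmxA e adj0.
have /envelop_mxP[z ->] := adj_envelop EZ.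
rewrite [col_sym mu *m _]mulmx_sumr [_ *m row_sym la]mulmx_suml => nz.
have [g nzg] : exists g, col_sym mu *m rG g *m row_sym la != 0.
  apply/existsP; apply: contraNT nz; rewrite negb_exists => /forallP z0.
  rewrite big1 // => g _; have := z0 g; rewrite negbK => /eqP e.
  by rewrite -scalemxAr -scalemxAl e scaler0.
by have [] := col_row_sym_neq0 le_n nzg.
Qed.

Definition specht_repr mu :=
  submod_repr (cyclic_mx_module rG (young_symmetrizer mu)).

(** Let the isomorphism send v = y_la X to y_mu. Some Y makes y_mu Y [ysym mu] a nonzero multiple of
    y_mu, so v Y [ysym mu] is nonzero as well, and [ysym_mul_neq0] applies to X Y. *)
Lemma specht_rsim_leq la mu :
  (nstat la <= nstat mu)%N -> mx_rsim (specht_repr la) (specht_repr mu) -> la = mu.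
Proof.
move=> le_n /mx_rsim_iso[f Uf homf eqf].
have [||Y EY [k nzk eY]] := @young_symmetrizer_return mu 1%:M.
- exact: envelop_mx1.
- by rewrite mulmx1 young_symmetrizer_neq0.
rewrite mulmx1 in eY.
have: (young_symmetrizer mu <= cyclic_mx rG (young_symmetrizer la) *m f)%MS.
  by rewrite eqf cyclic_mx_id.
case/submxP=> w; rewrite mulmxA; set v := w *m _ => ev.
have Vv : (v <= cyclic_mx rG (young_symmetrizer la))%MS by rewrite submxMl.
have [X EX eX] := cyclic_mxP Vv.
apply: (@ysym_mul_neq0 la mu (X *m Y)) => //; first by rewrite envelop_mxM.
apply/eqP=> e; have: v *m (Y *m ysym mu) *m f = 0.
  rewrite eX young_symmetrizerE -gring_row_mul -gring_row_mul.
  have -> : ysym la *m X *m (Y *m ysym mu) = ysym la *m (X *m Y) *m ysym mu.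
    by rewrite !mulmxA.
  rewrite e.
  by rewrite linear0 mul0mx.
rewrite (hom_envelop_mxC (submx_trans Vv homf)); last first.
  exact: envelop_mxM EY (mem_ysym mu).
rewrite -ev eY => /eqP.
by rewrite scaler_eq0 (negPf nzk) (negPf (young_symmetrizer_neq0 mu)).
Qed.

Lemma specht_char_inj : injective (@specht_char m).
Proof.
move=> la mu /cfRepr_inj sim.
have [le_n|/ltnW le_n] := leqP (nstat la) (nstat mu); first exact: specht_rsim_leq.
by apply/esym/specht_rsim_leq => //; apply: mx_rsim_sym.
Qed.

Lemma specht_char_irr mu : specht_char mu \in irr G.
Proof.
apply/irr_reprP; exists (Representation (specht_repr mu)) => //.
exact/submod_mx_irr/specht_simple.
Qed.

End YoungSymmetrizer.

(** * Invariants of the Specht modules *)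

(** In a full rank factorization E = C R, idempotence gives R C = 1, of size the rank. *)
Lemma mxtrace_idempotent n (E : 'M[algC]_n) : E *m E = E -> \tr E = (\rank E)%:R.
Proof.
move=> EE; rewrite -{1}[E]mulmx_base mxtrace_mulC.
suff -> : row_base E *m col_base E = 1%:M by rewrite mxtrace1.
have /row_freeP[R' RR'] := row_base_free E.
have /row_fullP[L LC] := col_base_full E.
have : col_base E *m row_base E *m (col_base E *m row_base E) = col_base E *m row_base E.
  by rewrite mulmx_base.
move/(congr1 (fun X => L *m X *m R')).
move: (col_base E) (row_base E) LC RR' => C R LC RR'.
by rewrite -!mulmxA RR' !mulmx1 !mulmxA LC !mul1mx.
Qed.

(** Averaging over [H] is an idempotent on the submodule: its trace is the inner product with the
    trivial character, its rank the dimension of the invariants. *)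
Lemma cfdot_Res_rank (gT : finGroupType) (G H : {group gT}) n
    (rG : mx_representation algC G n) (U : 'M_n) (modU : mxmodule rG U) :
    H \subset G ->
  '['Res[H] (cfRepr (submod_repr modU)), 1]_H = (\rank (U *m \sum_(h in H) rG h))%:R.
Proof.
move=> sHG; set rU := submod_repr modU.
pose E := #|H|%:R^-1 *: \sum_(h in H) rU h.
have nzH : #|H|%:R != 0 :> algC by rewrite pnatr_eq0 -lt0n cardG_gt0.
have EE : E *m E = E.
  have hE h : h \in H -> rU h *m E = E.
    move=> Hh; rewrite /E -scalemxAr; congr (_ *: _).
    rewrite mulmx_sumr [RHS](reindex_inj (mulgI h)) /=.
    apply: eq_big => x; first by rewrite groupMl.
    by move=> Hx; rewrite repr_mxM ?(subsetP sHG).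
  rewrite {1}/E -scalemxAl mulmx_suml (eq_bigr _ hE) sumr_const -scaler_nat.
  by rewrite scalerA mulVf // scale1r.
have -> : \rank (U *m \sum_(h in H) rG h) = \rank E.
  rewrite (eqmx_scale _ (invr_neq0 nzH)).
  rewrite -(mxrankMfree _ (row_base_free U)) -[_ *m row_base U]/(val_submod _).
  have -> : val_submod (\sum_(h in H) rU h) = val_submod 1%:M *m \sum_(h in H) rG h.
    rewrite linear_sum mulmx_sumr; apply: eq_bigr => h Hh /=.
    by rewrite -[rU h]mul1mx val_submodJ ?(subsetP sHG).
  by rewrite (eqmxMr _ (val_submod1 U)).
rewrite -mxtrace_idempotent // cfdotE mxtraceZ raddf_sum /=; congr (_ * _).
apply: eq_bigr => h Hh; rewrite cfun1E Hh conjC1 mulr1 cfResE // cfunE.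
by rewrite (subsetP sHG) // mulr1n.
Qed.

(** * Independent invariants from standard tableaux *)

Section StandardInvariants.

Variables (m k : nat).
Local Notation G := [set: 'S_m]%G.
Local Notation rG := (regular_repr algC G).
Implicit Types mu : intpart m.

Definition young_stab : {group 'S_m} :=
  Sym_group [set x : 'I_m | (x < m - k)%N].

(** The entry is a natural number so that [digits] can recurse on it; out of range entries get
    column 0. *)
Definition entry_col mu (s : 'S_m) (y : nat) :=
  if insub y is Some z then tcol mu (s^-1%g z) else 0%N.

Lemma entry_colE mu (s : 'S_m) (y : 'I_m) : entry_col mu s y = tcol mu (s^-1%g y).
Proof. by rewrite /entry_col valK. Qed.

(** The number with base m digits c 0, ..., c (n-1), most significant first. As columns are smaller
    than m, it turns the lexicographic order into the order of [nat]. *)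
Fixpoint digits (c : nat -> nat) n : nat :=
  if n is n'.+1 then digits c n' * m + c n' else 0.

Lemma eq_digits (c c' : nat -> nat) n :
  (forall z, (z < n)%N -> c z = c' z) -> digits c n = digits c' n.
Proof.
elim: n => //= n IH eq_c; rewrite IH ?eq_c // => z lt_z; apply: eq_c.
exact: ltn_trans lt_z _.
Qed.

(* The first entry that sits in different columns sits further right in t: in u it
   lies in the same row as in s, and the cells of that row further left than in s
   are occupied by smaller entries. *)
Lemma std_tableau_digits mu (s t u : 'S_m) : std_tableau k mu s ->
    (forall y, trow mu (u^-1%g y) = trow mu (s^-1%g y)) ->
    (forall y, tcol mu (u^-1%g y) = tcol mu (t^-1%g y)) ->
  forall n, (n <= m)%N ->
    (forall y : 'I_m, (y < n)%N -> tcol mu (s^-1%g y) = tcol mu (t^-1%g y)) \/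
    (digits (entry_col mu s) n < digits (entry_col mu t) n)%N.
Proof.
move=> /std_tableauP[_ std_s] ru cu; elim=> [|n IH] lt_n; first by left.
have col_lt s' : (entry_col mu s' n < m)%N.
  by rewrite -[n]/(val (Ordinal lt_n)) entry_colE tcol_ltm.
case: (IH (ltnW lt_n)) => [eq_c|lt_d] /=; last by right; have := col_lt s; nia.
pose y := Ordinal lt_n.
have le_c : (tcol mu (s^-1%g y) <= tcol mu (t^-1%g y))%N.
  rewrite leqNgt; apply/negP=> lt_c.
  pose x := u^-1%g y.
  have lt_x : (s x < y)%N.
    rewrite ltn_neqAle; apply/andP; split.
      apply: contraTneq lt_c => /val_inj sx; rewrite -sx permK -cu sx ltnn //.
    by rewrite -(permKV s y) std_s // ?ru // cu ltnW.
  have: u^-1%g (s x) = u^-1%g y.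
    apply: (@tcell_inj _ mu); first by rewrite ru permK.
    by rewrite cu -eq_c // permK.
  by move/perm_inj=> e; rewrite e ltnn in lt_x.
have digit s' : entry_col mu s' n = tcol mu (s'^-1%g y) by rewrite -entry_colE.
move: le_c; rewrite leq_eqVlt => /orP[/eqP eq_y|lt_c].
  left=> z; rewrite ltnS leq_eqVlt => /orP[/eqP ez|/eq_c //].
  by have -> : z = y by apply: val_inj.
right; rewrite !digit.
suff -> : digits (entry_col mu s) n = digits (entry_col mu t) n by rewrite ltn_add2l.
apply: eq_digits => z lt_z; have lt_zm := ltn_trans lt_z lt_n.
by rewrite -[z]/(val (Ordinal lt_zm)) !entry_colE eq_c.
Qed.

(** Once the smaller entries are placed, an entry must go to the first free cell of its column. *)
Lemma std_tableau_eq mu (s t : 'S_m) : std_tableau k mu s -> std_tableau k mu t ->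
  (forall y, tcol mu (s^-1%g y) = tcol mu (t^-1%g y)) -> s = t.
Proof.
move=> std_s std_t eq_c.
suff eq_r (y : 'I_m) : trow mu (s^-1%g y) = trow mu (t^-1%g y).
  apply: invg_inj; apply/permP=> y; exact: tcell_inj (eq_r y) (eq_c y).
have [n] := ubnP y; elim: n y => // n IH y; rewrite ltnS => le_y.
have half (s' t' : 'S_m) : std_tableau k mu s' -> std_tableau k mu t' ->
    (forall z, tcol mu (s'^-1%g z) = tcol mu (t'^-1%g z)) ->
    (forall z : 'I_m, (z < y)%N -> trow mu (s'^-1%g z) = trow mu (t'^-1%g z)) ->
  (trow mu (s'^-1%g y) <= trow mu (t'^-1%g y))%N.
  move=> /std_tableauP[_ std_s'] _ eq_c' eq_r'; rewrite leqNgt; apply/negP=> lt_r.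
  pose x := t'^-1%g y.
  have lt_x : (s' x < y)%N.
    rewrite ltn_neqAle; apply/andP; split.
      apply: contraTneq lt_r => /val_inj sx.
      by have -> : s'^-1%g y = x; [rewrite -sx permK | rewrite ltnn].
    by rewrite -(permKV s' y) std_s' // ?eq_c' // ltnW.
  have: t'^-1%g (s' x) = t'^-1%g y.
    apply: (@tcell_inj _ mu); first by rewrite -[LHS]eq_r' ?permK.
    by rewrite -[LHS]eq_c' permK.
  by move/perm_inj=> e; rewrite e ltnn in lt_x.
apply/eqP; rewrite eqn_leq; apply/andP; split.
  by apply: half => // z lt_z; apply: IH (leq_trans lt_z le_y).
by apply: half => // z lt_z; apply/esym/(IH z)/(leq_trans lt_z le_y).
Qed.

Definition young_stab_sum := \sum_(h in young_stab) rG h.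
(** The [young_stab]-invariant vector of the Specht module attached to [s]. *)
Definition std_vec mu (s : 'S_m) := young_symmetrizer mu *m (rG s *m young_stab_sum).
Definition std_coef mu (s t : 'S_m) := std_vec mu s 0 (gring_index G t).

Lemma std_coefE mu s t : std_coef mu s t =
  \sum_(q in col_group mu) \sum_(p in row_group mu) \sum_(h in young_stab)
     (-1) ^+ (q : 'S_m) *+ (q * p * s * h == t)%g.
Proof.
rewrite /std_coef /std_vec young_symmetrizerE -gring_row_mul.
rewrite {1}/ysym {1}/col_sym -mulmxA mulmx_suml linear_sum summxE; apply: eq_bigr => q _.
rewrite {1}/row_sym mulmx_suml mulmx_sumr linear_sum summxE; apply: eq_bigr => p _.
rewrite /young_stab_sum !mulmx_sumr linear_sum summxE; apply: eq_bigr => h _.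
rewrite -scalemxAl linearZ /= -!repr_mxM ?inE // !mulgA gring_row_regular !mxE eqxx.
rewrite -(inj_eq (can_inj (@gring_valK _ G))) !gring_indexK ?inE // eq_sym.
by case: (_ == t) => /=; rewrite ?mulr1 ?mulr0.
Qed.

(** [p] preserves rows, and [h] only permutes entries below m-k, all of which lie in row 0. *)
Lemma std_tableau_straighten mu (s : 'S_m) p h : std_tableau k mu s ->
    p \in row_group mu -> h \in young_stab ->
  forall y, trow mu ((p * s * h)^-1%g y) = trow mu (s^-1%g y).
Proof.
move=> /std_tableauP[row0 _] /row_groupP Rp; rewrite inE => hS y.
rewrite !invMg !permM -[in LHS]Rp permKV.
have hS' := perm_onV hS.
have [lt_y|ge_y] := ltnP y (m - k); last first.
  by rewrite (out_perm hS') // inE -leqNgt.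
rewrite [RHS]row0 ?permKV // row0 // permKV.
by have := perm_closed y hS'; rewrite !inE lt_y.
Qed.

(** A term contributing at [s] has q = 1, because p * s * h has the rows of [s] and then also its
    columns. So no sign is negative, and the identities contribute 1. *)
Lemma std_coef_diag mu s : std_tableau k mu s -> std_coef mu s s != 0.
Proof.
move=> std_s; have q1 q p h : q \in col_group mu -> p \in row_group mu ->
    h \in young_stab -> (q * p * s * h = s)%g -> q = 1%g.
  move=> Cq Rp Hh eq_s; apply: (mulIg s); rewrite mul1g.
  suff e : (p * s * h = s)%g by rewrite -{1}e !mulgA.
  apply: invg_inj; apply/permP=> y; apply: (@tcell_inj _ mu).
    exact: std_tableau_straighten.
  move/col_groupP: Cq => /(_ (s^-1%g y)) <-.
  by rewrite -[in RHS]eq_s -!mulgA (invMg q) permM permKV.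
rewrite std_coefE.
have ge0 q p h : q \in col_group mu -> p \in row_group mu -> h \in young_stab ->
    0 <= (-1) ^+ (q : 'S_m) *+ (q * p * s * h == s)%g :> algC.
  move=> Cq Rp Hh; case: eqP => //= /(q1 _ _ _ Cq Rp Hh) ->.
  by rewrite odd_perm1 ler01.
have R1 : 1%g \in row_group mu by apply/row_groupP=> x; rewrite perm1.
have C1 : 1%g \in col_group mu by apply/col_groupP=> x; rewrite perm1.
rewrite gt_eqF // (bigD1 _ C1) /= (bigD1 _ R1) /= (bigD1 _ (group1 _)) /=.
rewrite !mul1g mulg1 eqxx odd_perm1 mulr1n -!addrA ltr_wpDr ?ltr01 //.
apply: addr_ge0; [|apply: addr_ge0]; apply: sumr_ge0 => x /andP[Hx _].
- by have := ge0 _ _ _ C1 R1 Hx; rewrite !mul1g odd_perm1.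
- by apply: sumr_ge0 => h Hh; have := ge0 _ _ _ C1 Hx Hh; rewrite mul1g odd_perm1.
by apply: sumr_ge0 => p Rp; apply: sumr_ge0 => h Hh; apply: ge0.
Qed.

(** If q * p * s * h = t, then u = p * s * h has the rows of [s] and the columns of [t], as
    [std_tableau_digits] requires. *)
Lemma std_coef_triangular mu s t : std_tableau k mu s -> std_tableau k mu t ->
    std_coef mu s t != 0 ->
  s = t \/ (digits (entry_col mu s) m < digits (entry_col mu t) m)%N.
Proof.
move=> std_s std_t nz.
have [q [p [h [Cq Rp Hh eq_t]]]] : exists q p h,
    [/\ q \in col_group mu, p \in row_group mu, h \in young_stab & (q * p * s * h = t)%g].
  have [/existsP[q /existsP[p /existsP[h /and4P[? ? ? /eqP ?]]]]|none] := boolP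
    [exists q, exists p, exists h, [&& q \in col_group mu, p \in row_group mu,
       h \in young_stab & q * p * s * h == t]%g]; first by exists q, p, h.
  case/eqP: nz; rewrite std_coefE big1 // => q Cq; rewrite big1 // => p Rp.
  rewrite big1 // => h Hh; case: eqP => // eq_t; case/negP: none.
  apply/existsP; exists q; apply/existsP; exists p; apply/existsP; exists h.
  by rewrite Cq Rp Hh; apply/eqP.
have cu y : tcol mu ((p * s * h)^-1%g y) = tcol mu (t^-1%g y).
  move/col_groupP: Cq => /(_ (t^-1%g y)) <-.
  by rewrite -eq_t -!mulgA (invMg q) permM permKV !mulgA.
have [eq_c|] := std_tableau_digits std_s (std_tableau_straighten std_s Rp Hh) cu (leqnn m).
  by left; apply: std_tableau_eq std_s std_t _ => y; apply: eq_c.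
by right.
Qed.

Lemma card_std_tableau mu :
  (#|[set s | std_tableau k mu s]| <=
     \rank (cyclic_mx rG (young_symmetrizer mu) *m young_stab_sum))%N.
Proof.
set S := [set s | _].
pose M : 'M[algC]_(#|S|, _) := \matrix_i std_vec mu (enum_val i).
have freeM : row_free M.
  rewrite -kermx_eq0; apply/eqP/row_matrixP=> i; rewrite row0.
  have /sub_kermxP := row_sub i (kermx M); move: (row i _) => w {i} wM.
  apply/eqP/negPn/negP=> /rV0Pn[j0 nz0].
  (* In a linear relation take the tableau with the smallest [digits] among those with nonzero
     weight: by triangularity no other one contributes to its coefficient. *)
  pose W (i : 'I_#|S|) := digits (entry_col mu (enum_val i)) m.
  have [j nzj minj] := @arg_minnP _ j0 (fun i => w 0 i != 0) W nz0.
  have Sj : std_tableau k mu (enum_val j) by have := enum_valP j; rewrite inE.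
  have /rowP/(_ (gring_index G (enum_val j))) := wM.
  rewrite mxE (bigD1 j) //= big1 => [|i ne_ij].
    rewrite [M j _]mxE [RHS]mxE addr0 => /eqP; rewrite mulf_eq0 (negPf nzj) /= => /eqP e.
    by have := std_coef_diag Sj; rewrite /std_coef e eqxx.
  have [->|nzi] := eqVneq (w 0 i) 0; first by rewrite mul0r.
  have Si : std_tableau k mu (enum_val i) by have := enum_valP i; rewrite inE.
  rewrite [M i _]mxE -/(std_coef _ _ _).
  have [->|nzc] := eqVneq (std_coef mu (enum_val i) (enum_val j)) 0.
    by rewrite mulr0.
  case: (std_coef_triangular Si Sj nzc) => [/enum_val_inj e|].
    by rewrite e eqxx in ne_ij.
  by rewrite ltnNge (minj i nzi).
rewrite -(eqnP freeM) mxrankS //; apply/row_subP=> i; rewrite rowK /std_vec mulmxA.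
apply: submxMr; rewrite (mxmodule_trans (cyclic_mx_module _ _)) ?inE //.
exact: cyclic_mx_id.
Qed.

End StandardInvariants.

(** * Multiplicities and completeness of the Specht characters *)

Section Multiplicity.

Variable m : nat.
Local Notation G := [set: 'S_m]%G.
Local Notation rG := (regular_repr algC G).
Implicit Types mu : intpart m.

Definition fixdim k mu := \rank (cyclic_mx rG (young_symmetrizer mu) *m young_stab_sum m k).

Lemma cfdot_specht_stab k mu :
  '['Res[young_stab m k] (specht_char mu), 1] = (fixdim k mu)%:R.
Proof. exact: cfdot_Res_rank (subsetT _). Qed.

Lemma Crop_leq_fixdim k mu : (k <= m)%N -> (Crop mu k <= fixdim k mu)%N.
Proof. by move=> le_km; apply: leq_trans (Crop_leq_std mu le_km) (card_std_tableau _ _). Qed.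

Lemma card_ord_ltn n : (n <= m)%N -> #|[set x : 'I_m | (x < n)%N]| = n.
Proof.
move=> le_nm; rewrite -sum1_card (eq_bigl (fun x : 'I_m => (x < n)%N)) => [|x]; last by rewrite inE.
by rewrite -(big_ord_widen m (fun=> 1%N)) // sum1_card card_ord.
Qed.

Lemma card_young_stab k : #|young_stab m k| = (m - k)`!.
Proof. by rewrite card_Sym card_ord_ltn ?leq_subr. Qed.

(** For k = m the group [young_stab] is trivial, so every vector is invariant. *)
Lemma specht_char1 mu : specht_char mu 1%g = (fixdim m mu)%:R.
Proof.
rewrite -cfdot_specht_stab cfdotE card_young_stab subnn invr1 mul1r.
have -> : young_stab m m = 1%G.
  apply/val_inj/setP=> s; rewrite !inE subnn; apply/idP/eqP=> [on_s|->]; last exact: perm_on1.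
  by apply/permP=> x; rewrite perm1 (out_perm on_s) // inE ltn0.
by rewrite big_set1 cfResE ?sub1G ?set11 // cfun1E set11 conjC1 mulr1.
Qed.

Definition specht_Iirr mu : Iirr G := cfIirr (specht_char mu).

Lemma specht_IirrE mu : 'chi_(specht_Iirr mu) = specht_char mu.
Proof. exact: cfIirrE (specht_char_irr mu). Qed.

Lemma specht_Iirr_inj : injective specht_Iirr.
Proof. by move=> la mu e; apply: specht_char_inj; rewrite -!specht_IirrE e. Qed.

(** The sum is the multiplicity of the trivial character in the restricted regular character, which
    vanishes off the identity. *)
Lemma sum_irr_stab k : (k <= m)%N ->
  \sum_(i : Iirr G) 'chi_i 1%g * '['Res[young_stab m k] 'chi_i, 1] =
    (m`!)%:R / ((m - k)`!)%:R.
Proof.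
move=> le_km; set H := young_stab m k.
have -> : \sum_(i : Iirr G) 'chi_i 1%g * '['Res[H] 'chi_i, 1] = '['Res[H] (cfReg G), 1].
  rewrite cfReg_sum raddf_sum cfdot_suml; apply: eq_bigr => i _.
  by rewrite /= linearZ cfdotZl.
rewrite cfdotE card_young_stab mulrC (bigD1 1%g) //= big1 => [|h /andP[Hh nh]].
  by rewrite addr0 cfResE ?subsetT // cfRegE eqxx cfun1E group1 conjC1 mulr1 cardsT card_Sn.
by rewrite cfResE ?subsetT // cfRegE (negPf nh) mul0r.
Qed.

(** The Specht characters are distinct irreducibles, and the terms of [sum_irr_stab] left out are
    nonnegative. *)
Lemma sum_fixdim k : (k <= m)%N ->
  ((\sum_mu fixdim k mu * fixdim m mu) * (m - k)`! <= m`!)%N.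
Proof.
move=> le_km; rewrite -(ler_nat algC) natrM -ler_pdivlMr ?ltr0n ?fact_gt0 //.
rewrite -sum_irr_stab // natr_sum.
rewrite [X in _ <= X](bigID (mem (specht_Iirr @: setT))) /= big_imset; last first.
  by move=> la mu _ _; apply: specht_Iirr_inj.
rewrite /= [X in _ <= X + _](eq_bigl xpredT) => [|mu]; last by rewrite inE.
rewrite -[X in X <= _]addr0 lerD //.
  apply: ler_sum => mu _.
  by rewrite specht_IirrE cfdot_specht_stab specht_char1 natrM mulrC.
apply: sumr_ge0 => i _; rewrite mulr_ge0 ?(ltW (irr1_gt0 i)) //.
by rewrite natr_ge0 // Cnat_cfdot_char ?cfRes_char ?irr_char ?cfun1_char.
Qed.

(** The products are compared term by term, while [sum_Crop] and [sum_fixdim] compare their sums the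
    other way, so each pair of products agrees; then the positive factor [Crop mu m] is
    cancelled. *)
Lemma fixdim_Crop k mu : (k <= m)%N -> fixdim k mu = Crop mu k.
Proof.
move=> le_km; have le_c nu := Crop_leq_fixdim nu le_km.
have le_m nu := Crop_leq_fixdim nu (leqnn m).
have le_p nu : (Crop nu k * Crop nu m <= fixdim k nu * fixdim m nu)%N by apply: leq_mul.
have eq_p : (Crop mu k * Crop mu m = fixdim k mu * fixdim m mu)%N.
  apply/eqP; rewrite eqn_leq le_p /= leqNgt; apply/negP=> lt_p.
  have := sum_fixdim le_km; rewrite -(sum_Crop le_km) leq_pmul2r ?fact_gt0 // leqNgt.
  case/negP; rewrite (bigD1 mu) //= [X in (_ < X)%N](bigD1 mu) //=.
  by rewrite -addSn leq_add // leq_sum.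
have Cm_gt0 := Crop_gt0 mu.
apply/eqP; rewrite eqn_leq; apply/andP; split; last exact: le_c.
rewrite -(leq_pmul2r Cm_gt0) eq_p leq_mul2l; apply/orP; right.
exact: le_m.
Qed.

Lemma specht_char1E mu : specht_char mu 1%g = (Crop mu m)%:R.
Proof. by rewrite specht_char1 fixdim_Crop. Qed.

Lemma cfdot_specht_Crop k mu : (k <= m)%N ->
  '['Res[young_stab m k] (specht_char mu), 1] = (Crop mu k)%:R.
Proof. by move=> le_km; rewrite cfdot_specht_stab fixdim_Crop. Qed.

Lemma Crop_leq k mu : (k <= m)%N -> (Crop mu k <= Crop mu m)%N.
Proof.
move=> le_km; rewrite -!fixdim_Crop //.
have -> : fixdim m mu = \rank (cyclic_mx rG (young_symmetrizer mu)).
  apply/eqP; rewrite -(eqr_nat algC) -specht_char1 cfRepr1 //.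
exact: mxrankM_maxl.
Qed.

(** The squared degrees of the Specht characters already sum to m!, by [sum_Crop] with k = m, which
    leaves no room for another irreducible. *)
Lemma specht_Iirr_surj i : exists mu, specht_Iirr mu = i.
Proof.
have sum_sq : \sum_(mu : intpart m) specht_char mu 1%g ^+ 2 = (m`!)%:R.
  rewrite -(sum_Crop (leqnn m)) subnn muln1 natr_sum.
  by apply: eq_bigr => mu _; rewrite specht_char1E expr2 natrM.
suff: i \in specht_Iirr @: setT by case/imsetP=> mu _ ->; exists mu.
apply/negPn/negP=> nSi; have := irr_sum_square G.
rewrite (bigID (mem (specht_Iirr @: setT))) /= big_imset; last first.
  by move=> la mu _ _; apply: specht_Iirr_inj.
rewrite /= (eq_bigl xpredT) => [|mu]; last by rewrite inE.
under eq_bigr do rewrite specht_IirrE.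
rewrite sum_sq cardsT card_Sn => /eqP; rewrite -subr_eq0 addrAC subrr add0r.
rewrite psumr_eq0 => [|j _]; last by rewrite exprn_ge0 // ltW // irr1_gt0.
by move/allP/(_ i (mem_index_enum _)); rewrite nSi /= sqrf_eq0 (negPf (irr1_neq0 i)).
Qed.

Lemma specht_Iirr_bij : bijective specht_Iirr.
Proof.
have inv i : {mu | specht_Iirr mu == i}.
  by apply: sigW; have [mu <-] := specht_Iirr_surj i; exists mu.
exists (fun i => sval (inv i)) => [mu|i]; last by apply/eqP; case: (inv i).
by apply: specht_Iirr_inj; apply/eqP; case: (inv _).
Qed.

Lemma nfixJ (s t : 'S_m) : nfix (s ^ t)%g = nfix s.
Proof.
rewrite /nfix -[RHS](card_imset _ (@perm_inj _ t)); apply: eq_card => x.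
rewrite inE; apply/eqP/imsetP=> [fx|[y /[!inE]/eqP fy ->]]; last by rewrite permJ fy.
exists (t^-1%g x); rewrite ?permKV // inE; apply/eqP.
by apply: (@perm_inj _ t); rewrite -permJ permKV.
Qed.

(** A permutation carrying [A] onto [B] conjugates one subgroup into the other. *)
Lemma sum_stab_conj (phi : 'CF(G)) (A B : {set 'I_m}) : #|A| = #|B| ->
  \sum_(s in Sym_group A) phi s = \sum_(s in Sym_group B) phi s.
Proof.
case/perm_imset_ex=> g <-; rewrite [RHS](reindex_inj (conjg_inj g)) /=.
apply: eq_big => [s|s _]; last by rewrite cfunJ ?inE.
rewrite !inE; apply/idP/idP=> on_s; apply/subsetP=> x.
  rewrite inE -[x](permKV g) permJ (inj_eq (@perm_inj _ g)) => sx.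
  by rewrite imset_f // (subsetP on_s) // inE.
move=> /[!inE] sx; rewrite -(mem_imset _ _ (@perm_inj _ g)).
by apply: (subsetP on_s); rewrite inE permJ (inj_eq (@perm_inj _ g)).
Qed.

(** The binomial counts the k-subsets fixed pointwise by [s]. Exchanging sums leaves, for each
    subset, a sum over its pointwise stabilizer, which is conjugate to [young_stab]. *)
Lemma sum_bin_nfix k (phi : 'CF(G)) : (k <= m)%N ->
  \sum_(s in G) 'C(nfix s, k)%:R * phi s =
    ('C(m, k) * (m - k)`!)%:R * '['Res[young_stab m k] phi, 1].
Proof.
move=> le_km; have binE (s : 'S_m) : s \in G -> 'C(nfix s, k)%:R * phi s =
    \sum_(T : {set 'I_m} | #|T| == k) (if perm_on (~: T) s then phi s else 0).
  move=> _; rewrite /nfix -cards_draws -big_mkcondr /= sumr_const mulr_natl.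
  congr (_ *+ _); apply: eq_card => T; rewrite !inE andbC; congr (_ && _).
  apply/subsetP/subsetP=> sub x; first by rewrite !inE; apply: contra => /sub /[!inE].
  by move=> Tx; rewrite inE; apply: contraLR Tx => nfx; have := sub x nfx; rewrite inE.
rewrite (eq_bigr _ binE) exchange_big /=.
rewrite (eq_bigr (fun _ => \sum_(s in young_stab m k) phi s)) => [|T /eqP cardT_k].
  rewrite sumr_const natrM -mulrA -[X in _ *+ X](_ : 'C(m, k) = _).
    rewrite cfdotE card_young_stab mulVKf ?pnatr_eq0 -?lt0n ?fact_gt0 //.
    rewrite mulr_natl; congr (_ *+ _); apply: eq_bigr => s Hs.
    by rewrite cfResE ?subsetT // cfun1E Hs conjC1 mulr1.
  rewrite -[m in LHS]card_ord -card_draws; apply: eq_card => T.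
  by rewrite !inE.
rewrite -big_mkcondr /=; under eq_bigl do rewrite in_setT.
rewrite (eq_bigl (fun s => s \in Sym_group (~: T))) => [|s]; last by rewrite inE.
apply: sum_stab_conj; have := cardsC T; rewrite cardT_k card_ord => eT.
by rewrite card_ord_ltn ?leq_subr // -[in RHS]eT addKn.
Qed.

End Multiplicity.

(** * The spectrum *)

Lemma mup_prod_XsubC_exp (F : fieldType) (I : eqType) (r : seq I) (a : I -> F)
    (e : I -> nat) (l : F) :
  mup l (\prod_(i <- r) ('X - (a i)%:P) ^+ e i) = (\sum_(i <- r | a i == l) e i)%N.
Proof.
have nz i : ('X - (a i)%:P) ^+ e i != 0 by rewrite expf_neq0 ?polyXsubC_eq0.
elim: r => [|i r IH]; first by rewrite !big_nil mupNroot ?root1.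
rewrite !big_cons mupM ?IH ?mup_XsubCX ?nz //; first by case: ifP.
by rewrite prodf_seq_neq0; apply/allP=> j _; apply: nz.
Qed.

Section Spectrum.

Variables m k : nat.
Hypothesis le_km : (k <= m)%N.
Local Notation G := [set: 'S_m]%G.
Implicit Types mu : intpart m.

Definition bin_nfix (s : 'S_m) : algC := 'C(nfix s, k)%:R.

Lemma bin_nfixJ s t : s \in G -> t \in G -> bin_nfix (s ^ t)%g = bin_nfix s.
Proof. by rewrite /bin_nfix nfixJ. Qed.

Lemma lambdaE mu : lambda k mu =
  (\sum_(s in G) bin_nfix s * 'chi_(specht_Iirr mu) s) / 'chi_(specht_Iirr mu) 1%g.
Proof.
rewrite specht_IirrE sum_bin_nfix // cfdot_specht_Crop // -natrM.
by rewrite /lambda.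
Qed.

Lemma char_poly_ABinE : char_poly (ABin m k) =
  \prod_(mu : intpart m) ('X - (lambda k mu)%:P) ^+ (Crop mu m ^ 2).
Proof.
rewrite char_poly_ABin (char_poly_fun_op_regular bin_nfixJ).
rewrite (reindex (@specht_Iirr m)); last exact: onW_bij (specht_Iirr_bij m).
apply: eq_bigr => mu _; rewrite -lambdaE specht_IirrE specht_char1E.
by rewrite natrK.
Qed.

Lemma lambda_Crop mu :
  lambda k mu = ((Crop mu k)%:R / (k`!)%:R) / ((Crop mu m)%:R / (m`!)%:R).
Proof.
have nz n : (n`!)%:R != 0 :> algC by rewrite pnatr_eq0 -lt0n fact_gt0.
have nzC : (Crop mu m)%:R != 0 :> algC by rewrite pnatr_eq0 -lt0n Crop_gt0.
rewrite /lambda specht_char1E -(bin_fact le_km) !natrM.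
by field; rewrite nzC !nz pnatr_eq0 -lt0n bin_gt0 le_km.
Qed.

(** A rational algebraic integer is an integer. Grouped by conjugacy classes, the eigenvalue is a
    combination, with natural coefficients, of the algebraic integers |C| chi(C) / chi(1). *)
Lemma lambda_int mu : lambda k mu \is a Num.int.
Proof.
apply: Cint_rat_Aint.
  by rewrite /lambda specht_char1E rpred_div ?rpred_nat.
rewrite lambdaE sum_by_classes => [|s t Gs Gt]; last by rewrite bin_nfixJ // cfunJ.
rewrite mulr_suml rpred_sum // => _ /imsetP[s Gs ->].
have [t Gt ->] := repr_class G s.
rewrite bin_nfixJ // cfunJ // mulrCA -mulrA rpredM ?rpred_nat //.
exact: Aint_class_div_irr1.
Qed.

Lemma lambda_bounds mu : 0 <= lambda k mu <= ('C(m, k) * (m - k)`!)%:R.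
Proof.
have Cm : 0 < (Crop mu m)%:R :> algC by rewrite ltr0n Crop_gt0.
rewrite /lambda specht_char1E divr_ge0 ?ler0n //=.
by rewrite ler_pdivrMr // -natrM ler_nat leq_mul2l Crop_leq ?orbT.
Qed.

End Spectrum.

Theorem theorem3p9 (m k : nat) (hm : (1 <= m)%N) (hk : (k <= m)%N) :
  [/\ (forall mu : intpart m,
         lambda k mu = ((Crop mu k)%:R / (k`!)%:R) / ((Crop mu m)%:R / (m`!)%:R)),
      (forall mu : intpart m, eigenvalue (ABin m k) (lambda k mu)),
      (forall l : algC,
         (mup l (char_poly (ABin m k)))%:R =
           \sum_(mu : intpart m | lambda k mu == l) specht_char mu 1%g ^+ 2),
      (forall mu : intpart m, lambda k mu \is a Num.int)
    & (forall mu : intpart m,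
         0 <= lambda k mu <= ('C(m, k) * (m - k)`!)%:R)].
Proof.
split=> [mu|mu|l|mu|mu].
- exact: lambda_Crop.
- rewrite eigenvalue_root_char char_poly_ABinE // (bigD1 mu) //= rootM.
  have /prednK <- : (0 < Crop mu m ^ 2)%N by rewrite expn_gt0 Crop_gt0.
  by rewrite root_exp_XsubC eqxx.
- rewrite char_poly_ABinE // mup_prod_XsubC_exp natr_sum.
  by apply: eq_bigr => mu _; rewrite specht_char1E natrX.
- exact: lambda_int.
- exact: lambda_bounds.
Qed.
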